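(* Let $n\ge 2$ and let $g$ be a Riemannian metric on $\mathrm{SPD}(n)$. If $g$ is $\mathrm{O}(n)$-invariant, then there exist three maps $\gamma,\alpha:(0,\infty)^n\to(0,\infty)$ and $\beta:(0,\infty)^n\to\mathbb{R}$ such that for all $\Sigma=PDP^\top\in\mathrm{SPD}(n)$ (with $P\in\mathrm{O}(n)$, $D=\mathrm{Diag}(d_1,\dots,d_n)$, $d_i>0$) and all $X=PX'P^\top\in T_\Sigma\mathrm{SPD}(n)=\mathrm{Sym}(n)$: $$g_\Sigma(X,X)=g_D(X',X')=\sum_i\gamma(d_i,d_{k\ne i})X_{ii}'^2+\sum_{i\ne j}\alpha(d_i,d_j,d_{k\ne i,j})X_{ij}'^2+\sum_{i\ne j}\beta(d_i,d_j,d_{k\ne i,j})X'_{ii}X'_{jj},\qquad( * )$$ and such that: 1. (Compatibility) $\gamma=\alpha+\beta$ on the set $\{d\in(0,\infty)^n : d_1=d_2\}$; 2. (Positivity) for all $d\in(0,\infty)^n$, the symmetric matrix $S(d)$ defined by $S_{ii}(d)=\gamma(d_i,d_{k\ne i})$ and $S_{ij}(d)=\beta(d_i,d_j,d_{k\ne i,j})$ for $i\ne j$ is positive definite; 3. (Symmetry) $\gamma$ is $(1,n-1)$-symmetric and $\alpha,\beta$ are $(2,n-2)$-symmetric. Conversely, if $\gamma,\alpha:(0,\infty)^n\to(0,\infty)$ and $\beta:(0,\infty)^n\to\mathbb{R}$ satisfy conditions 1, 2 and 3, then $( * )$ correctly defines (i.e. independently of the chosen eigenvalue decomposition $\Sigma=PDP^\top$)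 an $\mathrm{O}(n)$-invariant Riemannian metric on $\mathrm{SPD}(n)$. Moreover, $g$ is continuous if and only if $\alpha,\beta,\gamma$ are continuous.
   Context: $\mathrm{Sym}(n)$ is the space of real symmetric $n\times n$ matrices, $\mathrm{SPD}(n)\subset\mathrm{Sym}(n)$ the open set of symmetric positive definite matrices, $\mathrm{O}(n)$ the orthogonal group. The tangent space $T_\Sigma\mathrm{SPD}(n)$ is identified with $\mathrm{Sym}(n)$. In this statement a Riemannian metric $g$ on $\mathrm{SPD}(n)$ means an assignment of an inner product $g_\Sigma$ on $\mathrm{Sym}(n)$ to each $\Sigma\in\mathrm{SPD}(n)$, with no regularity assumed a priori; it is continuous if $\Sigma\mapsto g_\Sigma$ is continuous. It is $\mathrm{O}(n)$-invariant if $g_{R\Sigma R^\top}(RXR^\top,RXR^\top)=g_\Sigma(X,X)$ for all $R\in\mathrm{O}(n)$, $\Sigma\in\mathrm{SPD}(n)$, $X\in\mathrm{Sym}(n)$. A function $f:(0,\infty)^n\to\mathbb{R}$ is $(k,n-k)$-symmetric if it is invariant under permutations of its first $k$ variables and under permutations of its last $n-k$ variables. For such $f$, and for $d\in(0,\infty)^n$ and $I\subseteq\{1,\dots,n\}$ of cardinality $k$, $f(d_{i\in I},d_{i\notin I})$ denotes the value of $f$ at the vector whose first $k$ entries are the $d_i$, $i\in I$, and whose last $n-k$ entries are the $d_i$, $i\notin I$ (in any orders). Thus $\gamma(d_i,d_{k\ne i})$ is $\gamma$ evaluated with $d_i$ in first position and the other $d_k$'s afterwards, and $\alpha(d_i,d_j,d_{k\ne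 i,j})$ is $\alpha$ evaluated with $d_i,d_j$ in the first two positions and the other $d_k$'s afterwards (same for $\beta$). *)

(* Defs.v *)
From mathcomp Require Import all_boot all_order all_fingroup all_algebra.
From mathcomp Require Import all_classical all_reals all_analysis.

Set Implicit Arguments.
Unset Strict Implicit.
Unset Printing Implicit Defensive.

Import Order.TTheory GRing.Theory Num.Theory.
Import numFieldNormedType.Exports.

Local Open Scope classical_set_scope.
Local Open Scope ring_scope.

Section SPDMetrics.
Variables (R : realType) (n : nat).

Definition spd (S : 'M[R]_n) : Prop :=
  S \is symmetricmx /\
  forall x : 'cV[R]_n, x != 0 -> 0 < (x^T *m S *m x) 0 0.

Definition orthogonal_mx (P : 'M[R]_n) : Prop := P *m P^T = 1%:M.

(* The elements of (0, oo)^n are the row vectors with positive entries; functions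
   on (0, oo)^n are total functions on row vectors, of which only the values on
   positive vectors matter. In the same way, only the values g S X Y with S
   symmetric positive definite and X, Y symmetric matter for a metric g. *)
Definition positive_vec (d : 'rV[R]_n) : Prop := forall i, 0 < d 0 i.

Definition inner_product_Sym (b : 'M[R]_n -> 'M[R]_n -> R) : Prop :=
  [/\ forall (a : R) (X Y Z : 'M[R]_n),
        X \is symmetricmx -> Y \is symmetricmx -> Z \is symmetricmx ->
        b (a *: X + Y) Z = a * b X Z + b Y Z,
      forall X Y : 'M[R]_n, X \is symmetricmx -> Y \is symmetricmx ->
        b X Y = b Y X
    & forall X : 'M[R]_n, X \is symmetricmx -> X != 0 -> 0 < b X X].

Definition riemannian_metric (g : 'M[R]_n -> 'M[R]_n -> 'M[R]_n -> R) : Prop :=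
  forall S, spd S -> inner_product_Sym (g S).

(* Bilinear forms on Sym(n) make up a finite-dimensional space, so that
   S |-> g S is continuous as soon as all its evaluations are. *)
Definition continuous_metric (g : 'M[R]_n -> 'M[R]_n -> 'M[R]_n -> R) : Prop :=
  forall X Y : 'M[R]_n, X \is symmetricmx -> Y \is symmetricmx ->
    {within [set S | spd S], continuous (fun S : 'M[R]_n => g S X Y)}.

Definition orthogonal_invariant (g : 'M[R]_n -> 'M[R]_n -> 'M[R]_n -> R) : Prop :=
  forall Q S X : 'M[R]_n, orthogonal_mx Q -> spd S -> X \is symmetricmx ->
    g (Q *m S *m Q^T) (Q *m X *m Q^T) (Q *m X *m Q^T) = g S X X.

Definition symmetric_fun (k : nat) (f : 'rV[R]_n -> R) : Prop :=
  (forall (s : 'S_n) (d : 'rV[R]_n), positive_vec d ->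
     perm_on [set i : 'I_n | (i < k)%N]%SET s -> f (col_perm s d) = f d) /\
  (forall (s : 'S_n) (d : 'rV[R]_n), positive_vec d ->
     perm_on [set i : 'I_n | (k <= i)%N]%SET s -> f (col_perm s d) = f d).

(* [to_front I d] lists the d_i for i in I, then the other entries of d in
   increasing order of index; I is to be duplicate-free. The default value of
   [nth] is never used, as the list of indices then has length n. *)
Definition to_front (I : seq 'I_n) (d : 'rV[R]_n) : 'rV[R]_n :=
  \row_k d 0 (nth k (I ++ [seq j <- enum 'I_n | j \notin I]) k).

Variables gamma alpha beta : 'rV[R]_n -> R.

Definition metric_formula (d : 'rV[R]_n) (X : 'M[R]_n) : R :=
  \sum_i gamma (to_front [:: i] d) * X i i ^+ 2
  + \sum_i \sum_(j | i != j) alpha (to_front [:: i; j] d) * X i j ^+ 2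
  + \sum_i \sum_(j | i != j) beta (to_front [:: i; j] d) * (X i i * X j j).

Definition metric_given_by (g : 'M[R]_n -> 'M[R]_n -> 'M[R]_n -> R) : Prop :=
  forall (S P X X' : 'M[R]_n) (d : 'rV[R]_n),
    spd S -> X \is symmetricmx -> orthogonal_mx P -> positive_vec d ->
    S = P *m diag_mx d *m P^T -> X = P *m X' *m P^T ->
    g S X X = g (diag_mx d) X' X' /\
    g (diag_mx d) X' X' = metric_formula d X'.

Definition formula_well_defined : Prop :=
  forall (S P Q X X' X'' : 'M[R]_n) (d e : 'rV[R]_n),
    spd S -> X \is symmetricmx ->
    orthogonal_mx P -> positive_vec d -> orthogonal_mx Q -> positive_vec e ->
    S = P *m diag_mx d *m P^T -> X = P *m X' *m P^T ->
    S = Q *m diag_mx e *m Q^T -> X = Q *m X'' *m Q^T ->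
    metric_formula d X' = metric_formula e X''.

Definition positive_valued (f : 'rV[R]_n -> R) : Prop :=
  forall d, positive_vec d -> 0 < f d.

(* Indices start at 0: d_1 and d_2 are the entries of d of indices 0 and 1. *)
Definition compatibility : Prop :=
  forall (d : 'rV[R]_n) (i j : 'I_n), i = 0%N :> nat -> j = 1%N :> nat ->
    positive_vec d -> d 0 i = d 0 j -> gamma d = alpha d + beta d.

Definition positivity_mx (d : 'rV[R]_n) : 'M[R]_n :=
  \matrix_(i, j) if i == j then gamma (to_front [:: i] d)
                 else beta (to_front [:: i; j] d).

Definition positivity : Prop :=
  forall d, positive_vec d -> spd (positivity_mx d).

Definition symmetry : Prop :=
  [/\ symmetric_fun 1 gamma, symmetric_fun 2 alpha & symmetric_fun 2 beta].

Definition admissible : Prop :=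
  [/\ positive_valued gamma, positive_valued alpha,
      compatibility, positivity & symmetry].

End SPDMetrics.

Definition continuous_on_positive (R : realType) (n : nat)
    (f : 'rV[R]_n -> R) : Prop :=
  {within [set d | positive_vec d], continuous f}.

(* Main.v *)
Require Import Defs.
From mathcomp Require Import all_boot all_order all_fingroup all_algebra.
From mathcomp Require Import all_classical all_reals all_analysis.
From mathcomp Require Import complex ring lra.

(* Necessity: polarising the invariance, conjugation by sign matrices fixes a
   diagonal D and kills the coefficients g_D(E_ij, E_kl) absent from the formula;
   permutation matrices give the symmetries, and a reflection of the plane of
   the first two axes, which fixes D when d_1 = d_2, gives gamma = alpha + beta.
   Well-definedness: if P D P^T = Q E Q^T then M = Q^T P satisfies M D = E M, so that
   M_ik <> 0 forces e_i = d_k.  Compatibility allows to rewrite the formula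
   as sum_ij A_ij X_ij^2 + sum_ij B_ij X_ii X_jj, where now i = j is allowed and A_ij
   and B_ij only depend on the values d_i and d_j; such a formula is invariant under M.
   Continuity: near S, the value g_S'(X, X) is the formula evaluated at
   Q^T S' Q and Q^T X Q for any Q in O(n) diagonalising S'; since O(n) is compact, the
   continuity of the formula at each Q diagonalising S suffices. *)

Set Implicit Arguments.
Unset Strict Implicit.
Unset Printing Implicit Defensive.

Import Order.TTheory GRing.Theory Num.Theory.
Import numFieldNormedType.Exports.

Local Open Scope classical_set_scope.
Local Open Scope ring_scope.

(** * The spectral theorem for real symmetric matrices *)

Lemma tr_scalar_prod (R : comPzRingType) n (x y : 'rV[R]_n) (S : 'M[R]_n) :
  S^T = S -> x *m S *m y^T = y *m S *m x^T.
Proof.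
move=> Ssym; rewrite [LHS](_ : _ = (x *m S *m y^T)^T).
  by rewrite !trmx_mul trmxK Ssym mulmxA.
by rewrite [LHS]mx11_scalar [in RHS](mx11_scalar (_ *m y^T)) tr_scalar_mx.
Qed.

Lemma dot_ge0 (R : realDomainType) n (x : 'rV[R]_n) : 0 <= (x *m x^T) 0 0.
Proof.
by rewrite mxE sumr_ge0// => i _; rewrite mxE -expr2 sqr_ge0.
Qed.

Lemma dot_eq0 (R : realDomainType) n (x : 'rV[R]_n) : (x *m x^T) 0 0 = 0 -> x = 0.
Proof.
rewrite mxE => /eqP; rewrite psumr_eq0 => [|i _]; last by rewrite mxE -expr2 sqr_ge0.
move=> /allP x0; apply/rowP => i; have := x0 i; rewrite mem_index_enum => /(_ isT).
by rewrite !mxE mulf_eq0 orbb => /eqP.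
Qed.

(** Over the algebraically closed field [R[i]] there is an eigenvector v = x + iy for some p + iq.
    Real and imaginary parts give xS = px - qy and yS = py + qx. Symmetry of S equates xSy^T and
    ySx^T, so q(|x|^2 + |y|^2) = 0 and q = 0; whichever of x and y is nonzero is then a real
    eigenvector. *)
Lemma symmetric_eigenvector (R : rcfType) n (S : 'M[R]_n) : (0 < n)%N -> S^T = S ->
  exists (a : R) (v : 'rV[R]_n), v != 0 /\ v *m S = a *: v.
Proof.
move=> n_gt0 Ssym.
pose A := map_mx (real_complex R) S.
have [a /eigenvalueP[v vA v_neq0]] := eigenvalue_closed A n_gt0.
pose x := map_mx (@complex.Re R) v; pose y := map_mx (@complex.Im R) v.
have xS : x *m S = complex.Re a *: x - complex.Im a *: y.
  apply/rowP => j; have := congr1 (fun z : 'rV[R[i]]_n => complex.Re (z 0 j)) vA.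
  rewrite !mxE; case: {+}a (v 0 j) => [p q] [r s] /= <-.
  rewrite raddf_sum; apply: eq_bigr => k _; rewrite !mxE /=.
  by case: (v 0 k) => r' s' /=; rewrite mulr0 subr0.
have yS : y *m S = complex.Re a *: y + complex.Im a *: x.
  apply/rowP => j; have := congr1 (fun z : 'rV[R[i]]_n => complex.Im (z 0 j)) vA.
  rewrite !mxE; case: {+}a (v 0 j) => [p q] [r s] /= <-.
  rewrite raddf_sum; apply: eq_bigr => k _; rewrite !mxE /=.
  by case: (v 0 k) => r' s' /=; rewrite mulr0 add0r.
have xy0 : ~ (x = 0 /\ y = 0).
  move=> [/rowP x0 /rowP y0]; case/eqP: v_neq0; apply/rowP => j.
  by have := x0 j; have := y0 j; rewrite !mxE; case: (v 0 j) => r s /= -> ->.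
have := congr1 (fun M : 'M[R]_1 => M 0 0) (tr_scalar_prod x y Ssym).
have yx : (y *m x^T) 0 0 = (x *m y^T) 0 0.
  by rewrite !mxE; apply: eq_bigr => i _; rewrite !mxE mulrC.
rewrite xS yS !mulmxDl !mulNmx -!scalemxAl !mxE; move: yx; rewrite !mxE => ->.
move: (dot_ge0 x) (dot_ge0 y) (@dot_eq0 _ _ x) (@dot_eq0 _ _ y).
rewrite !mxE; set px := \sum_j _; set py := \sum_j _ => px0 py0 x0 y0.
move: xS yS; case: a vA => p q /= vA xS yS pq.
have /eqP : q * (px + py) = 0 by lra.
rewrite mulf_eq0 => /orP[/eqP q0|/eqP pxy]; last first.
  by case: xy0; split; [apply: x0|apply: y0]; lra.
move: xS yS; rewrite q0 !scale0r subr0 addr0 => xS yS.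
exists p; have [x_eq0|x_neq0] := eqVneq x 0; last by exists x.
by exists y; split=> //; apply/eqP => y_eq0; apply: xy0.
Qed.

(* The Householder reflection; at v = 0, where 2 / 0 = 0, it is the identity. *)
Definition reflection (R : fieldType) n (v : 'rV[R]_n) : 'M[R]_n :=
  1%:M - (2 / (v *m v^T) 0 0) *: (v^T *m v).

Lemma reflection_tr (R : fieldType) n (v : 'rV[R]_n) : (reflection v)^T = reflection v.
Proof. by rewrite /reflection linearB linearZ /= trmx1 trmx_mul trmxK. Qed.

Lemma mul_reflection (R : fieldType) m n (v : 'rV[R]_n) (A : 'M[R]_(m, n)) :
  A *m reflection v = A - (2 / (v *m v^T) 0 0) *: (A *m v^T *m v).
Proof. by rewrite mulmxBr mulmx1 -scalemxAr mulmxA. Qed.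

Lemma reflectionK (R : realFieldType) n (v : 'rV[R]_n) :
  reflection v *m reflection v = 1%:M.
Proof.
have [v0|v_neq0] := eqVneq v 0.
  by rewrite /reflection v0 !mulmx0 scaler0 subr0 mulmx1.
have vv : (v *m v^T) 0 0 != 0 by apply: contra_neq v_neq0; apply: dot_eq0.
have Rv : reflection v *m v^T = - v^T.
  rewrite mulmxBl mul1mx -scalemxAl -mulmxA {2}[v *m v^T]mx11_scalar mul_mx_scalar.
  by rewrite scalerA divfK// scaler_nat mulr2n opprD addrA subrr sub0r.
by rewrite mul_reflection Rv mulNmx scalerN opprK subrK.
Qed.

(** For vectors of equal length, |v - w|^2 = 2 v.(v - w), so the reflection along v - w subtracts
    exactly v - w from v. *)
Lemma reflection_exists (R : rcfType) n (v w : 'rV[R]_n) :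
  (v *m v^T) 0 0 = (w *m w^T) 0 0 -> v *m reflection (v - w) = w.
Proof.
move=> vw; rewrite mul_reflection.
have [vw0|vw_neq0] := eqVneq (v - w) 0.
  by rewrite vw0 !(mul0mx, mulmx0) scaler0 subr0; apply/eqP; rewrite -subr_eq0 vw0.
have : ((v - w) *m (v - w)^T) 0 0 != 0 by apply: contra_neq vw_neq0; apply: dot_eq0.
have wv : (w *m v^T) 0 0 = (v *m w^T) 0 0.
  by rewrite !mxE; apply: eq_bigr => i _; rewrite !mxE mulrC.
have -> : ((v - w) *m (v - w)^T) 0 0 = 2 * (v *m (v - w)^T) 0 0.
  rewrite linearB /= mulmxBl !mulmxBr; move: vw wv; rewrite !mxE => -> ->; ring.
rewrite [v *m (_)^T]mx11_scalar mul_scalar_mx scalerA !mxE => h.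
rewrite invfM mulrA mulfV ?pnatr_eq0// mul1r mulVf.
  by rewrite scale1r subKr.
by apply: contra_neq h => ->; rewrite mulr0.
Qed.

(** Induction on the size: a reflection H carries a unit eigenvector to the first basis vector e, so
    that HSH is block diagonal and the induction applies to its lower right block. *)
Lemma spectral_theorem (R : rcfType) n (S : 'M[R]_n) : S^T = S ->
  exists (P : 'M[R]_n) (d : 'rV[R]_n), P *m P^T = 1%:M /\ S = P *m diag_mx d *m P^T.
Proof.
elim: n S => [|n IH] S Ssym; first by exists 0, 0; split; apply/matrixP; case.
have [a [v0 [v0_neq0 v0S]]] := symmetric_eigenvector (ltn0Sn n) Ssym.
have v0v0 : 0 < (v0 *m v0^T) 0 0.
  by rewrite lt_def dot_ge0 andbT; apply: contra_neq v0_neq0; apply: dot_eq0.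
pose v := (Num.sqrt ((v0 *m v0^T) 0 0))^-1 *: v0.
have vS : v *m S = a *: v by rewrite -scalemxAl v0S !scalerA mulrC.
have vv : (v *m v^T) 0 0 = 1.
  rewrite linearZ /= -scalemxAr -scalemxAl mxE [(_ *: _ : 'M[R]_1) _ _]mxE mulrA.
  by rewrite -invfM -expr2 sqr_sqrtr ?mulVf ?gt_eqF// ltW.
pose e : 'rV[R]_(1 + n) := row_mx 1%:M 0.
have ee : (e *m e^T) 0 0 = 1.
  by rewrite tr_row_mx mul_row_col trmx1 trmx0 mulmx0 addr0 mulmx1 mxE.
pose H := reflection (v - e).
have vH : v *m H = e by apply: reflection_exists; rewrite vv ee.
have eH : e *m H = v by rewrite -vH -mulmxA reflectionK mulmx1.
pose T : 'M[R]_(1 + n) := H *m S *m H.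
have Tsym : T^T = T by rewrite /T !trmx_mul Ssym reflection_tr mulmxA.
have eT : e *m T = a *: e by rewrite /T !mulmxA eH vS -scalemxAl vH.
(* The equation eT = ae reads off the first row of T; the first column follows later by symmetry. *)
have [ulT urT] : ulsubmx T = a%:M /\ ursubmx T = 0.
  move: eT; rewrite -[T]submxK mul_row_block mul0mx !mul1mx !addr0 mul0mx addr0.
  rewrite scale_row_mx scaler0 => /eq_row_mx[-> ->].
  by rewrite block_mxKul block_mxKur scale_scalar_mx mulr1.
have [P [d [PP Tdr]]] : exists (P : 'M[R]_n) (d : 'rV[R]_n),
    P *m P^T = 1%:M /\ drsubmx T = P *m diag_mx d *m P^T.
  by apply: IH; rewrite trmx_drsub Tsym.
pose Q : 'M[R]_(1 + n) := block_mx 1%:M 0 0 P.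
have QQ : Q *m Q^T = 1%:M.
  rewrite /Q tr_block_mx mulmx_block !trmx0 trmx1 PP !(mulmx0, mul0mx, mulmx1).
  by rewrite !(addr0, add0r) -scalar_mx_block.
exists (H *m Q), (row_mx a%:M d); split.
  by rewrite trmx_mul mulmxA -(mulmxA H) QQ mulmx1 reflection_tr reflectionK.
have TE : T = Q *m diag_mx (row_mx a%:M d : 'rV[R]_(1 + n)) *m Q^T.
  rewrite -[T]submxK ulT urT -[dlsubmx _]trmxK trmx_dlsub Tsym urT Tdr diag_mx_row.
  rewrite /Q tr_block_mx !mulmx_block !trmx0 trmx1 !(mulmx0, mul0mx, mulmx1, mul1mx).
  rewrite !(addr0, add0r); congr block_mx; rewrite ?mul0mx //.
  by apply/matrixP => i j; rewrite !ord1 !mxE eqxx.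
transitivity (H *m T *m H).
  by rewrite /T !mulmxA reflectionK mul1mx -mulmxA reflectionK mulmx1.
by rewrite TE trmx_mul reflection_tr !mulmxA.
Qed.

(** * Permuting the variables of symmetric functions *)

Section SymmetricFunctions.
Variables (R : realType) (n : nat).
Implicit Types (d : 'rV[R]_n) (f : 'rV[R]_n -> R) (I J : seq 'I_n) (s u v : 'S_n).

Definition first_indices (k : nat) : {set 'I_n} := [set i : 'I_n | (i < k)%N]%SET.

Lemma positive_col_perm s d : positive_vec d -> positive_vec (col_perm s d).
Proof. by move=> d0 i; rewrite mxE. Qed.

Lemma col_perm_mul s u d : col_perm (s * u)%g d = col_perm s (col_perm u d).
Proof. by apply/rowP => i; rewrite !mxE permM. Qed.

(** The list in [to_front] is a duplicate-free enumeration of all indices, hence a permutation. It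
    does not depend on d, which reduces every statement on [to_front] to one on [col_perm]. *)
Lemma to_front_perm I : uniq I ->
  exists s, (forall d, to_front I d = col_perm s d) /\
            (forall k : 'I_n, (k < size I)%N -> s k = nth k I k).
Proof.
move=> uI; pose l := I ++ [seq j <- enum 'I_n | j \notin I].
have ul : uniq l.
  rewrite cat_uniq uI filter_uniq ?enum_uniq// andbT /=.
  by apply/hasPn => j; rewrite mem_filter => /andP[].
have lT : perm_eq l (enum 'I_n).
  apply: uniq_perm => //; first exact: enum_uniq.
  move=> j; rewrite mem_cat mem_filter mem_enum /= !inE andbT.
  by case: (j \in I).
have sl : size l = n by rewrite (perm_size lT) size_enum_ord.
have inj : injective (fun k : 'I_n => nth k l k).
  move=> j k /=; rewrite (set_nth_default k) ?sl// => /eqP.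
  by rewrite nth_uniq ?sl// => /eqP/val_inj.
exists (perm inj); split=> [d|k kI]; last by rewrite permE nth_cat kI.
by apply/rowP => k; rewrite !mxE permE.
Qed.

(** The permutation w = u v^-1 stabilises the first k indices, so it factors as w1 w2 with w1
    supported on them and w2 on the others; f absorbs each factor. *)
Lemma symmetric_fun_imset k f u v d : symmetric_fun k f -> positive_vec d ->
  u @: first_indices k = v @: first_indices k -> f (col_perm u d) = f (col_perm v d).
Proof.
move=> [fl fr] d_gt0; set A := first_indices k => uvA.
pose w := (u * v^-1)%g.
have wA : w \in ('N(A | 'P))%g.
  apply/astabsP => x; rewrite /= /aperm permM.
  have <- : (u x \in u @: A) = (x \in A) by rewrite mem_imset//; exact: perm_inj.
  by rewrite uvA -(mem_imset A _ (@perm_inj _ v)) permKV.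
pose w1 := restr_perm A w; pose w2 := (w1^-1 * w)%g.
have -> : u = (w1 * (w2 * v))%g by rewrite /w2 /w !mulgA mulgV mul1g mulgKV.
have w1A : perm_on A w1 by exact: restr_perm_on.
rewrite col_perm_mul fl//; last exact: positive_col_perm.
rewrite col_perm_mul fr//; first exact: positive_col_perm.
rewrite /perm_on; apply/fintype.subsetP => x; rewrite !inE; apply: contraR; rewrite -ltnNge => xk.
have xA : x \in A by rewrite inE.
have yA : (w1^-1)%g x \in A by rewrite -(perm_closed _ w1A) permKV.
by rewrite permM -(restr_permE wA yA) permKV.
Qed.

Lemma imset_first_indices I s : uniq I ->
  (forall k : 'I_n, (k < size I)%N -> s k = nth k I k) ->
  s @: first_indices (size I) = [set x in I]%SET.
Proof.
move=> uI sk; apply/setP => x; rewrite inE; apply/imsetP/idP => [[j]|xI].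
  by rewrite inE => jk ->; rewrite sk// mem_nth.
have jn : (index x I < n)%N.
  rewrite (leq_trans (n := size I)) ?index_mem//.
  by rewrite -[n in (_ <= n)%N]card_ord -(card_uniqP uI) max_card.
exists (Ordinal jn); first by rewrite inE index_mem.
by rewrite sk /= ?index_mem// nth_index.
Qed.

(** On both sides the first k positions are filled from the index set s(I), which is all that f
    detects. *)
Lemma to_front_col_perm k f I s d : symmetric_fun k f -> positive_vec d ->
  uniq I -> size I = k -> f (to_front I (col_perm s d)) = f (to_front (map s I) d).
Proof.
move=> fS d_gt0 uI sI; have [u [ud uk]] := to_front_perm uI.
have usI : uniq (map s I) by rewrite map_inj_uniq//; exact: perm_inj.
have [v [vd vk]] := to_front_perm usI.
rewrite ud vd -col_perm_mul; apply: (symmetric_fun_imset fS) => //.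
have := imset_first_indices usI vk; rewrite size_map sI => ->.
have := imset_first_indices uI uk; rewrite sI => uE.
apply/setP => x; rewrite inE; apply/imsetP/mapP => [[y yk ->]|[y yI ->]].
  exists (u y); last by rewrite permM.
  have : u y \in [set x in I]%SET by rewrite -uE imset_f.
  by rewrite inE.
have : y \in [set x in I]%SET by rewrite inE.
rewrite -uE => /imsetP[z zk ->].
by exists z => //; rewrite permM.
Qed.

Lemma to_front_eq_mem k f I J d : symmetric_fun k f -> positive_vec d ->
  uniq I -> size I = k -> uniq J -> size J = k -> I =i J ->
  f (to_front I d) = f (to_front J d).
Proof.
move=> fS d_gt0 uI sI uJ sJ IJ.
have [u [ud uk]] := to_front_perm uI; have [v [vd vk]] := to_front_perm uJ.
rewrite ud vd; apply: (symmetric_fun_imset fS) => //.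
have := imset_first_indices uI uk; have := imset_first_indices uJ vk.
by rewrite sI sJ => -> ->; apply/setP => x; rewrite !inE IJ.
Qed.

Lemma to_front2C f i j d : symmetric_fun 2 f -> positive_vec d -> i != j ->
  f (to_front [:: i; j] d) = f (to_front [:: j; i] d).
Proof.
move=> fS d_gt0 ij; apply: to_front_eq_mem fS d_gt0 _ _ _ _ _ => //=.
- by rewrite inE ij.
- by rewrite inE eq_sym ij.
by move=> x; rewrite !inE orbC.
Qed.

Lemma col_perm_tperm i j d : d 0 i = d 0 j -> col_perm (tperm i j) d = d.
Proof. by move=> dij; apply/rowP => k; rewrite mxE; case: tpermP => [->|->|]. Qed.

(** A product of two transpositions, each exchanging equal entries, fixes d and sends (i, j) to (i',
    j'). The second one starts from the image of j, as the first may move j. *)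
Lemma to_front2_eq f i j i' j' d : symmetric_fun 2 f -> positive_vec d ->
  i != j -> i' != j' -> d 0 i = d 0 i' -> d 0 j = d 0 j' ->
  f (to_front [:: i; j] d) = f (to_front [:: i'; j'] d).
Proof.
move=> fS d_gt0 ij i'j' dii' djj'.
have dE : d 0 (tperm i i' j) = d 0 j'.
  by have /rowP/(_ j) := col_perm_tperm dii'; rewrite mxE => ->.
pose s := (tperm i i' * tperm (tperm i i' j) j')%g.
have sd : col_perm s d = d by rewrite col_perm_mul (col_perm_tperm dE) col_perm_tperm.
rewrite -{1}sd (to_front_col_perm _ fS)//= ?inE ?ij//.
rewrite !permM !tpermL [tperm (tperm i i' j) j' i']tpermD// 1?eq_sym//.
by rewrite -{1}(tpermL i i') (inj_eq perm_inj).
Qed.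

End SymmetricFunctions.

(** * Invariance of the formula *)

Section Intertwining.
Variables (R : fieldType) (n : nat) (Q : 'M[R]_n).
Hypothesis QQ : Q^T *m Q = 1%:M.
Implicit Types X : 'M[R]_n.

(** The hypothesis says that diag(c) Q = Q diag(c'), and the sum is the trace of diag(c) Q X Q^T. *)
Lemma trace_intertwine X (c c' : 'I_n -> R) :
  (forall i k, Q i k != 0 -> c i = c' k) ->
  \sum_i c i * (Q *m X *m Q^T) i i = \sum_i c' i * X i i.
Proof.
move=> cc'.
have E (e : 'I_n -> R) (Y : 'M[R]_n) : \sum_i e i * Y i i = \tr (diag_mx (\row_i e i) *m Y).
  by apply: eq_bigr => i _; rewrite mul_diag_mx !mxE.
have cQ : diag_mx (\row_i c i) *m Q = Q *m diag_mx (\row_i c' i).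
  apply/matrixP => i k; rewrite mul_diag_mx mul_mx_diag !mxE mulrC.
  by have [->|/cc'->//] := eqVneq (Q i k) 0; rewrite !mul0r.
by rewrite !E !mulmxA cQ mxtrace_mulC !mulmxA QQ mul1mx.
Qed.

(** Entrywise multiplication by the weights, written M, commutes with the conjugation: a term Q_ik
    X_kl Q_jl is nonzero only if a_ij = a'_kl. The sum is the trace of M(Y) Y^T with Y = Q X Q^T,
    and the trace is invariant under conjugation by Q. *)
Lemma sqr_sum_intertwine X (a a' : 'I_n -> 'I_n -> R) :
  (forall i j k l, Q i k != 0 -> Q j l != 0 -> a i j = a' k l) ->
  \sum_i \sum_j a i j * (Q *m X *m Q^T) i j ^+ 2 = \sum_i \sum_j a' i j * X i j ^+ 2.
Proof.
move=> aa'; pose M (b : 'I_n -> 'I_n -> R) (Y : 'M[R]_n) : 'M[R]_n :=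
  \matrix_(i, j) (b i j * Y i j).
have E b (Y : 'M[R]_n) : \sum_i \sum_j b i j * Y i j ^+ 2 = \tr (M b Y *m Y^T).
  apply: eq_bigr => i _; rewrite mxE; apply: eq_bigr => j _.
  by rewrite !mxE expr2 mulrA.
have aQ : M a (Q *m X *m Q^T) = Q *m M a' X *m Q^T.
  apply/matrixP => i j; rewrite !mxE mulr_sumr; apply: eq_bigr => l _.
  rewrite !mxE !mulr_suml mulr_sumr; apply: eq_bigr => k _; rewrite !mxE.
  have [->|Qik] := eqVneq (Q i k) 0; first by rewrite !(mul0r, mulr0).
  have [->|Qjl] := eqVneq (Q j l) 0; first by rewrite !(mul0r, mulr0).
  by rewrite (aa' _ _ _ _ Qik Qjl); ring.
rewrite !E aQ !trmx_mul trmxK mxtrace_mulC !mulmxA -(mulmxA _ _ Q) QQ mulmx1.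
by rewrite mxtrace_mulC !mulmxA QQ mul1mx mxtrace_mulC.
Qed.

(** A nonzero determinant has a nonzero term in its Leibniz expansion. *)
Lemma unitmx_perm_neq0 (M : 'M[R]_n) : M \in unitmx ->
  exists s : 'S_n, forall i, M i (s i) != 0.
Proof.
rewrite unitmxE unitfE => detM; apply: contrapT => noperm.
case/eqP: detM; rewrite /determinant big1// => s _.
have [i Mi0] : exists i, M i (s i) = 0.
  apply: contrapT => Mn0; apply: noperm; exists s => i.
  by apply/eqP => Mi0; apply: Mn0; exists i.
by rewrite (bigD1 i)//= Mi0 mul0r mulr0.
Qed.

(** Entry (i, k) of the equation is Q_ik d_k = e_i Q_ik; a permutation along which Q has no zero
    entry then matches e with d. *)
Lemma intertwine_perm (d e : 'rV[R]_n) : Q *m diag_mx d = diag_mx e *m Q ->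
  (forall i k, Q i k != 0 -> e 0 i = d 0 k) /\ exists s, e = col_perm s d.
Proof.
move=> Qde.
have ed i k : Q i k != 0 -> e 0 i = d 0 k.
  move=> Qik; have := congr1 (fun M : 'M[R]_n => M i k) Qde.
  by rewrite mul_diag_mx mul_mx_diag !mxE mulrC => /(mulIf Qik).
split=> //; have [s sQ] := unitmx_perm_neq0 (mulmx1_unit QQ).2.
by exists s; apply/rowP => i; rewrite mxE (ed _ _ (sQ i)).
Qed.

End Intertwining.

(** * Coefficients depending on a pair of eigenvalues *)

Section PairCoefficient.
Variables (R : realType) (n : nat) (f h : 'rV[R]_n -> R).
Implicit Types (d : 'rV[R]_n) (s : 'S_n).
Hypotheses (fS : symmetric_fun 2 f) (hS : symmetric_fun 1 h).

(* Extends f(d_i, d_j, ...) to i = j so that it only depends on the values d_i and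
   d_j; the value h is taken when d_i is a simple entry of d. *)
Definition pair_coef d i j : R :=
  if i != j then f (to_front [:: i; j] d)
  else if [pick k | (k != i) && (d 0 k == d 0 i)] is Some k
       then f (to_front [:: i; k] d) else h (to_front [:: i] d).

(** If i = j, the entry d_i also occurs at k and at l, one of which differs from i. So [pick]
    succeeds, and its choice is immaterial by [to_front2_eq]. *)
Lemma pair_coefE d i j k l : positive_vec d -> k != l ->
  d 0 k = d 0 i -> d 0 l = d 0 j -> pair_coef d i j = f (to_front [:: k; l] d).
Proof.
move=> d_gt0 kl dki dlj; rewrite /pair_coef.
have [ij|ij] := eqVneq i j; last exact: to_front2_eq.
rewrite -{}ij {j} in dlj *.
case: pickP => [m /andP[mi /eqP dmi]|no] /=.
  by apply: to_front2_eq; rewrite // 1?eq_sym// dmi.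
have [ki|ki] := eqVneq k i; last by have := no k; rewrite /= ki dki eqxx.
by have := no l; rewrite /= -ki eq_sym kl dlj ki eqxx.
Qed.

Lemma pair_coef_eq d i j i' j' : positive_vec d ->
  d 0 i = d 0 i' -> d 0 j = d 0 j' -> pair_coef d i j = pair_coef d i' j'.
Proof.
move=> d_gt0 di dj; have [ij|ij] := eqVneq i j; last first.
  by rewrite (pair_coefE d_gt0 ij)// [RHS](pair_coefE d_gt0 ij).
have [i'j'|i'j'] := eqVneq i' j'; last first.
  by rewrite (pair_coefE d_gt0 i'j')// [RHS](pair_coefE d_gt0 i'j').
(* Both pairs are diagonal: if i and i' differ, they form themselves a pair of distinct indices with
   equal entries, to which [pair_coefE] compares both sides. *)
move: dj; rewrite -ij -i'j' => _; have [->//|ii'] := eqVneq i i'.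
by rewrite (pair_coefE d_gt0 ii')// [RHS](pair_coefE d_gt0 ii').
Qed.

Lemma pair_coef_col_perm d s i j : positive_vec d ->
  pair_coef (col_perm s d) i j = pair_coef d (s i) (s j).
Proof.
move=> d_gt0; have [<-|ij] := eqVneq i j; last first.
  rewrite /pair_coef (inj_eq perm_inj) ij (to_front_col_perm _ fS)//=.
  by rewrite inE ij.
rewrite {1}/pair_coef eqxx /=; case: pickP => [k /andP[ki]|no].
  rewrite !mxE => /eqP dki; rewrite (to_front_col_perm _ fS)//= ?inE 1?eq_sym ?ki//.
  by rewrite (@pair_coefE d _ _ (s i) (s k))// (inj_eq perm_inj) eq_sym.
rewrite /pair_coef eqxx /= (to_front_col_perm _ hS)//=; case: pickP => // k.
by have := no (s^-1 k)%g; rewrite /= !mxE permKV -(inj_eq (@perm_inj _ s)) permKV => ->.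
Qed.

(** Supplies the hypothesis on weights in [sqr_sum_intertwine] and [trace_intertwine]. *)
Lemma pair_coef_intertwine (Q : 'M[R]_n) d e : positive_vec d ->
  Q^T *m Q = 1%:M -> Q *m diag_mx d = diag_mx e *m Q ->
  forall i j k l, Q i k != 0 -> Q j l != 0 -> pair_coef e i j = pair_coef d k l.
Proof.
move=> d_gt0 QQ /(intertwine_perm QQ)[ed [s es]] i j k l Qik Qjl.
rewrite es pair_coef_col_perm//; apply: pair_coef_eq => //.
  by rewrite -(ed _ _ Qik) es mxE.
by rewrite -(ed _ _ Qjl) es mxE.
Qed.

End PairCoefficient.

Lemma symmetric_fun_cst (R : realType) n k (c : R) :
  symmetric_fun k (fun _ : 'rV[R]_n => c).
Proof. by split. Qed.

(** * The formula as an invariant inner product *)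

Section Formula.
Variables (R : realType) (n : nat) (i0 i1 : 'I_n).
Hypotheses (i0E : i0 = 0%N :> nat) (i1E : i1 = 1%N :> nat).
Variables gamma alpha beta : 'rV[R]_n -> R.
Hypothesis adm : admissible gamma alpha beta.
Implicit Types (d : 'rV[R]_n) (X Y : 'M[R]_n).

Let gS : symmetric_fun 1 gamma. Proof. by case: adm => _ _ _ _ []. Qed.
Let aS : symmetric_fun 2 alpha. Proof. by case: adm => _ _ _ _ []. Qed.
Let bS : symmetric_fun 2 beta. Proof. by case: adm => _ _ _ _ []. Qed.

(** Both arguments start with d_i, and [gamma] is symmetric in its other variables. *)
Lemma gamma_front2 d i j : positive_vec d -> i != j ->
  gamma (to_front [:: i; j] d) = gamma (to_front [:: i] d).
Proof.
move=> d_gt0 ij.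
have [|u [-> uk]] := @to_front_perm R _ [:: i; j]; first by rewrite /= inE ij.
have [//|v [-> vk]] := @to_front_perm R _ [:: i].
apply: (symmetric_fun_imset gS d_gt0).
have -> : first_indices n 1 = [set i0]%SET.
  by apply/setP => k; rewrite !inE ltnS leqn0 -i0E.
by rewrite !imset_set1 uk ?vk i0E.
Qed.

(** When d_i is a simple entry, the default values [gamma] and 0 add up to [gamma]. Otherwise some
    d_k equals d_i, and this is the compatibility condition at [to_front [:: i; k] d]. *)
Lemma gamma_pair_coef d i : positive_vec d ->
  gamma (to_front [:: i] d) =
  pair_coef alpha gamma d i i + pair_coef beta (fun=> 0) d i i.
Proof.
move=> d_gt0; have compat : compatibility gamma alpha beta by case: adm.
rewrite /pair_coef eqxx /=; case: pickP => [k /andP[ki /eqP dki]|_]; last by rewrite addr0.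
have ik : i != k by rewrite eq_sym.
rewrite -(gamma_front2 d_gt0 ik).
have [|u [ud uk]] := @to_front_perm R _ [:: i; k]; first by rewrite /= inE ik.
apply: (compat _ i0 i1) => //; rewrite ud; first exact: positive_col_perm.
by rewrite !mxE !uk ?i0E ?i1E//= dki.
Qed.

(** The last sum is nested so that [trace_intertwine] applies to it twice, once for each index. *)
Lemma metric_formula_pair_coef d X : positive_vec d ->
  metric_formula gamma alpha beta d X =
  \sum_i \sum_j pair_coef alpha gamma d i j * X i j ^+ 2 +
  \sum_j (\sum_i pair_coef beta (fun=> 0) d i j * X i i) * X j j.
Proof.
move=> d_gt0.
have E (F : 'I_n -> 'I_n -> R) : \sum_i \sum_j F i j =
    \sum_i F i i + \sum_i \sum_(j | i != j) F i j.
  rewrite -big_split; apply: eq_bigr => i _; rewrite (bigD1 i)//=; congr (_ + _).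
  by apply: eq_bigl => j; rewrite eq_sym.
under [X in _ = _ + X]eq_bigr do rewrite mulr_suml.
rewrite [X in _ = _ + X]exchange_big /= !E /metric_formula [RHS]addrACA.
rewrite -[LHS]addrA; congr (_ + _); last congr (_ + _).
- by rewrite -big_split; apply: eq_bigr => i _; rewrite gamma_pair_coef//=; ring.
- by apply: eq_bigr => i _; apply: eq_bigr => j ij; rewrite /pair_coef ij.
by apply: eq_bigr => i _; apply: eq_bigr => j ij; rewrite /pair_coef ij mulrA.
Qed.

Lemma metric_formula_intertwine (Q : 'M[R]_n) d e X : positive_vec d -> positive_vec e ->
  Q^T *m Q = 1%:M -> Q *m diag_mx d = diag_mx e *m Q ->
  metric_formula gamma alpha beta e (Q *m X *m Q^T) =
  metric_formula gamma alpha beta d X.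
Proof.
move=> d_gt0 e_gt0 QQ Qde.
have aE := pair_coef_intertwine aS gS d_gt0 QQ Qde.
have bE := pair_coef_intertwine bS (symmetric_fun_cst n 1 (0 : R)) d_gt0 QQ Qde.
rewrite !metric_formula_pair_coef//; congr (_ + _).
  exact: sqr_sum_intertwine.
apply: trace_intertwine => // j l Qjl; apply: trace_intertwine => // i k Qik.
exact: bE.
Qed.

Definition bilinear_formula d X Y : R :=
  \sum_i gamma (to_front [:: i] d) * (X i i * Y i i)
  + \sum_i \sum_(j | i != j) alpha (to_front [:: i; j] d) * (X i j * Y i j)
  + \sum_i \sum_(j | i != j) beta (to_front [:: i; j] d) * (X i i * Y j j).

Lemma bilinear_formula_diag d X :
  bilinear_formula d X X = metric_formula gamma alpha beta d X.
Proof. by []. Qed.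

Lemma bilinear_formulaP d (a : R) X Y Z :
  bilinear_formula d (a *: X + Y) Z = a * bilinear_formula d X Z + bilinear_formula d Y Z.
Proof.
rewrite /bilinear_formula !mulrDr [RHS]addrACA [X in _ = X + _]addrACA.
congr (_ + _ + _).
- rewrite mulr_sumr -big_split; apply: eq_bigr => i _; rewrite !mxE /=; ring.
- rewrite mulr_sumr -big_split; apply: eq_bigr => i _ /=.
  rewrite mulr_sumr -big_split; apply: eq_bigr => j _ /=; rewrite !mxE; ring.
- rewrite mulr_sumr -big_split; apply: eq_bigr => i _ /=.
  rewrite mulr_sumr -big_split; apply: eq_bigr => j _ /=; rewrite !mxE; ring.
Qed.

(** In the third sum, exchanging i and j swaps the first two arguments of [beta], which is symmetric
    in them. *)
Lemma bilinear_formulaC d X Y : positive_vec d ->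
  bilinear_formula d X Y = bilinear_formula d Y X.
Proof.
move=> d_gt0; rewrite /bilinear_formula; congr (_ + _ + _).
- by apply: eq_bigr => i _; rewrite [X i i * _]mulrC.
- by apply: eq_bigr => i _; apply: eq_bigr => j _; rewrite [X i j * _]mulrC.
rewrite (exchange_big_dep predT)//=; apply: eq_bigr => j _.
under eq_bigl do rewrite eq_sym.
by apply: eq_bigr => i ji; rewrite (to_front2C bS d_gt0 ji) [X i i * _]mulrC.
Qed.

(** The formula is a nonnegative off-diagonal part plus the quadratic form of S(d) at the diagonal x
    of X. Either x is nonzero and S(d) gives positivity, or X has a nonzero off-diagonal entry and
    [alpha] does. *)
Lemma metric_formula_gt0 d X : positive_vec d -> X^T = X -> X != 0 ->
  0 < metric_formula gamma alpha beta d X.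
Proof.
move=> d_gt0 XT X_neq0; have [_ a_gt0 _ pos _] := adm.
have front_gt0 i j : 0 < alpha (to_front [:: i; j] d).
  apply: a_gt0 => k; rewrite mxE; exact: d_gt0.
pose x : 'cV[R]_n := \col_i X i i.
pose S := positivity_mx gamma beta d.
have xSx : (x^T *m S *m x) 0 0 = \sum_i \sum_j X i i * S i j * X j j.
  rewrite mxE exchange_big; apply: eq_bigr => j _.
  by rewrite !mxE mulr_suml; apply: eq_bigr => i _; rewrite !mxE.
have -> : metric_formula gamma alpha beta d X =
    \sum_i \sum_(j | i != j) alpha (to_front [:: i; j] d) * X i j ^+ 2
    + (x^T *m S *m x) 0 0.
  rewrite /metric_formula addrAC addrC; congr (_ + _).
  rewrite xSx -big_split; apply: eq_bigr => i _ /=.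
  rewrite [RHS](bigD1 i)//= !mxE eqxx; congr (_ + _); first by ring.
  under [RHS]eq_bigl do rewrite eq_sym.
  by apply: eq_bigr => j ij; rewrite !mxE (negPf ij); ring.
have sum_ge0 i : 0 <= \sum_(j | i != j) alpha (to_front [:: i; j] d) * X i j ^+ 2.
  by apply: sumr_ge0 => j _; rewrite mulr_ge0 ?sqr_ge0// ltW.
have [_ posS] := pos _ d_gt0.
have [x0|x_neq0] := eqVneq x 0; last by rewrite ltr_wpDl ?posS// sumr_ge0.
rewrite x0 mulmx0 mxE addr0 lt_def sumr_ge0 ?andbT//.
apply: contra_neq X_neq0 => /eqP; rewrite psumr_eq0// => /allP Xi0.
apply/matrixP => i j; rewrite mxE; have [<-|ij] := eqVneq i j.
  by have /colP/(_ i) := x0; rewrite !mxE.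
have := Xi0 i; rewrite mem_index_enum => /(_ isT).
rewrite psumr_eq0 => [/allP/(_ j)|k _]; last by rewrite mulr_ge0 ?sqr_ge0// ltW.
rewrite mem_index_enum ij => /(_ isT) /=.
by rewrite mulf_eq0 gt_eqF//= sqrf_eq0 => /eqP.
Qed.

End Formula.

(** * The metric defined by the formula *)

Section Spd.
Variables (R : realType) (n : nat).
Implicit Types (S P Q X Y : 'M[R]_n) (d : 'rV[R]_n).

Lemma symmetricmxP X : reflect (X^T = X) (X \is symmetricmx).
Proof.
by apply: (iffP (is_hermitianmxP _ _ _)); rewrite expr0 scale1r map_mx_id.
Qed.

Lemma symmetricmx_conj Q X : X \is symmetricmx -> Q *m X *m Q^T \is symmetricmx.
Proof. by move=> /symmetricmxP XT; apply/symmetricmxP; rewrite !trmx_mul trmxK XT mulmxA. Qed.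

Lemma symmetricmx_lin (a : R) X Y : X \is symmetricmx -> Y \is symmetricmx ->
  a *: X + Y \is symmetricmx.
Proof.
move=> /symmetricmxP XT /symmetricmxP YT.
by apply/symmetricmxP; rewrite linearD linearZ /= XT YT.
Qed.

Lemma symmetricmx_add X Y : X \is symmetricmx -> Y \is symmetricmx ->
  X + Y \is symmetricmx.
Proof. by move=> XS YS; have := symmetricmx_lin 1 XS YS; rewrite scale1r. Qed.

Lemma orthogonal_trmx P : orthogonal_mx P -> orthogonal_mx P^T.
Proof. by move=> PP; rewrite /orthogonal_mx trmxK; apply: mulmx1C. Qed.

Lemma orthogonal_mul P Q : orthogonal_mx P -> orthogonal_mx Q -> orthogonal_mx (P *m Q).
Proof.
by move=> PP QQ; rewrite /orthogonal_mx trmx_mul mulmxA -(mulmxA P) QQ mulmx1.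
Qed.

Lemma orthogonal_conjK Q X : orthogonal_mx Q -> Q^T *m (Q *m X *m Q^T) *m Q = X.
Proof. by move=> /mulmx1C QQ; rewrite !mulmxA QQ mul1mx -mulmxA QQ mulmx1. Qed.

Lemma orthogonal_conjVK Q X : orthogonal_mx Q -> Q *m (Q^T *m X *m Q) *m Q^T = X.
Proof. by move=> QQ; rewrite !mulmxA QQ mul1mx -mulmxA QQ mulmx1. Qed.

Lemma spd_diag d : positive_vec d -> spd (diag_mx d).
Proof.
move=> d_gt0; split; first by apply/symmetricmxP; rewrite tr_diag_mx.
move=> x x_neq0; have xdx i : 0 <= (x^T *m diag_mx d) 0 i * x i 0.
  by rewrite mul_mx_diag !mxE mulrAC mulr_ge0 -?expr2 ?sqr_ge0// ltW.
rewrite mxE lt_def sumr_ge0 ?andbT//; apply: contra_neq x_neq0 => /eqP.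
rewrite psumr_eq0// => /allP x0; apply/colP => i; have := x0 i.
rewrite mem_index_enum => /(_ isT); rewrite mul_mx_diag !mxE mulrAC /= mulf_eq0.
by rewrite (gt_eqF (d_gt0 i)) orbF mulf_eq0 orbb => /eqP.
Qed.

Lemma spd_conj Q S : orthogonal_mx Q -> spd S -> spd (Q *m S *m Q^T).
Proof.
move=> QQ [Ssym Spos]; split=> [|x x_neq0]; first exact: symmetricmx_conj.
have /Spos : Q^T *m x != 0.
  by apply: contra_neq x_neq0 => Qx; rewrite -[x]mul1mx -QQ -mulmxA Qx mulmx0.
by rewrite trmx_mul trmxK !mulmxA.
Qed.

Lemma spd_diag_positive d : spd (diag_mx d) -> positive_vec d.
Proof.
move=> [_ dpos] i; have := dpos (delta_mx i 0).
have -> : (delta_mx i 0 : 'cV[R]_n) != 0.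
  apply/eqP => /colP/(_ i)/eqP; rewrite !mxE !eqxx /=.
  by rewrite oner_eq0.
move=> /(_ isT); rewrite -colE trmx_delta -rowE !mxE eqxx.
by rewrite mulr1n.
Qed.

Lemma spd_eigendecomposition S : spd S -> exists P d,
  [/\ orthogonal_mx P, positive_vec d & S = P *m diag_mx d *m P^T].
Proof.
move=> Sspd; have /symmetricmxP/spectral_theorem[P [d [PP Sd]]] := Sspd.1.
exists P, d; split=> //; apply: spd_diag_positive.
have := spd_conj (orthogonal_trmx PP) Sspd.
by rewrite Sd trmxK orthogonal_conjK.
Qed.

(** Invariance and the formula only concern g(X, X); this identity carries them over to g(X, Y). *)
Lemma inner_product_polarization (b : 'M[R]_n -> 'M[R]_n -> R) X Y :
  inner_product_Sym b -> X \is symmetricmx -> Y \is symmetricmx ->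
  b X Y = (b (X + Y) (X + Y) - b X X - b Y Y) / 2.
Proof.
move=> [blin bC _] XS YS.
have XYS := symmetricmx_add XS YS.
have bD U V W : U \is symmetricmx -> V \is symmetricmx -> W \is symmetricmx ->
  b (U + V) W = b U W + b V W.
  by move=> US VS WS; rewrite -[U in b (U + _)]scale1r blin// mul1r.
rewrite bD// (bC X (X + Y))// (bC Y (X + Y))// !bD// (bC Y X)//. by field.
Qed.

End Spd.

(** * Existence and uniqueness of the metric with given coefficients *)

Section MetricOfFormula.
Variables (R : realType) (n : nat) (i0 i1 : 'I_n).
Hypotheses (i0E : i0 = 0%N :> nat) (i1E : i1 = 1%N :> nat).
Variables gamma alpha beta : 'rV[R]_n -> R.
Hypothesis adm : admissible gamma alpha beta.
Implicit Types (S P Q X Y : 'M[R]_n) (d : 'rV[R]_n).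

Lemma formula_well_definedP : formula_well_defined gamma alpha beta.
Proof.
move=> S P Q X X' X'' d e _ _ PP d_gt0 QQ e_gt0 Sd XX' Se XX''.
have -> : X'' = (Q^T *m P) *m X' *m (Q^T *m P)^T.
  rewrite trmx_mul trmxK; transitivity (Q^T *m X *m Q).
    by rewrite XX'' orthogonal_conjK.
  by rewrite XX' !mulmxA.
apply/esym/(metric_formula_intertwine i0E i1E adm) => //.
  by apply: mulmx1C; apply: orthogonal_mul => //; exact: orthogonal_trmx.
(* With M = Q^T P, both M D and E M are equal to Q^T S P. *)
have QTQ := mulmx1C QQ; have PTP := mulmx1C PP.
transitivity (Q^T *m S *m P); first by rewrite Sd -!mulmxA PTP mulmx1.
by rewrite Se !mulmxA QTQ mul1mx.
Qed.

(** A choice of P and d for each S; the default, identity and constant 1, is taken only when no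
    decomposition exists. *)
Definition eigendecomposition S : 'M[R]_n * 'rV[R]_n :=
  xget (1%:M, const_mx 1) [set Pd | [/\ orthogonal_mx Pd.1, positive_vec Pd.2 &
                              S = Pd.1 *m diag_mx Pd.2 *m Pd.1^T]]%classic.

Definition metric_of_formula S X Y : R :=
  let P := (eigendecomposition S).1 in
  bilinear_formula gamma alpha beta (eigendecomposition S).2
    (P^T *m X *m P) (P^T *m Y *m P).

Lemma eigendecompositionP S : spd S ->
  [/\ orthogonal_mx (eigendecomposition S).1, positive_vec (eigendecomposition S).2 &
   S = (eigendecomposition S).1 *m diag_mx (eigendecomposition S).2
         *m (eigendecomposition S).1^T].
Proof.
move=> /spd_eigendecomposition[P [d Pd]].
exact: (@xgetPex _ (1%:M, const_mx 1) [set Pd | [/\ orthogonal_mx Pd.1,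
  positive_vec Pd.2 & S = Pd.1 *m diag_mx Pd.2 *m Pd.1^T]]%classic (ex_intro _ (P, d) Pd)).
Qed.

Lemma metric_of_formulaE S P d X' : spd S -> orthogonal_mx P -> positive_vec d ->
  S = P *m diag_mx d *m P^T -> X' \is symmetricmx ->
  metric_of_formula S (P *m X' *m P^T) (P *m X' *m P^T) =
  metric_formula gamma alpha beta d X'.
Proof.
move=> Sspd PP d_gt0 Sd XS; have [QQ e_gt0 Se] := eigendecompositionP Sspd.
rewrite /metric_of_formula bilinear_formula_diag.
apply: (formula_well_definedP Sspd (symmetricmx_conj P XS)) Se _ Sd _ => //.
by rewrite orthogonal_conjVK.
Qed.

(** Once S is fixed, so is the chosen P, and the metric at S is the pullback of [bilinear_formula]
    by the automorphism X |-> P^T X P of Sym(n). *)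
Lemma metric_of_formula_riemannian : riemannian_metric metric_of_formula.
Proof.
move=> S /eigendecompositionP[].
rewrite /metric_of_formula; set P := _.1; set d := _.2 => PP d_gt0 _; split.
- by move=> a X Y Z _ _ _; rewrite mulmxDr mulmxDl -scalemxAr -scalemxAl bilinear_formulaP.
- by move=> X Y _ _; rewrite (bilinear_formulaC adm).
move=> X XS X_neq0; rewrite bilinear_formula_diag.
apply: (metric_formula_gt0 adm) => //.
  by apply/symmetricmxP; have := symmetricmx_conj P^T XS; rewrite trmxK.
by apply: contra_neq X_neq0 => PX; rewrite -[X](orthogonal_conjVK _ PP) PX mulmx0 mul0mx.
Qed.

(** If P diagonalises S, then QP diagonalises Q S Q^T with the same d and the same X', and the
    formula does not depend on the decomposition. *)
Lemma metric_of_formula_invariant : orthogonal_invariant metric_of_formula.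
Proof.
move=> Q S X QQ Sspd XS; have [P [d [PP d_gt0 Sd]]] := spd_eigendecomposition Sspd.
have X'S : P^T *m X *m P \is symmetricmx.
  by have := symmetricmx_conj P^T XS; rewrite trmxK.
have QPconj (Y : 'M[R]_n) : Q *m (P *m Y *m P^T) *m Q^T = (Q *m P) *m Y *m (Q *m P)^T.
  by rewrite trmx_mul !mulmxA.
rewrite -(orthogonal_conjVK X PP) QPconj (metric_of_formulaE Sspd PP d_gt0)//.
apply: metric_of_formulaE => //; last by rewrite Sd QPconj.
- exact: spd_conj.
- exact: orthogonal_mul.
Qed.

Lemma metric_of_formula_given_by : metric_given_by gamma alpha beta metric_of_formula.
Proof.
move=> S P X X' d Sspd XS PP d_gt0 Sd XX'.
have X'E : X' = P^T *m X *m P by rewrite XX' orthogonal_conjK.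
have X'S : X' \is symmetricmx by have := symmetricmx_conj P^T XS; rewrite trmxK -X'E.
rewrite XX' (metric_of_formulaE Sspd PP d_gt0)//.
have one : orthogonal_mx (1%:M : 'M[R]_n) by rewrite /orthogonal_mx trmx1 mulmx1.
have := @metric_of_formulaE (diag_mx d) 1%:M d X' (spd_diag d_gt0) one d_gt0.
by rewrite trmx1 !mul1mx !mulmx1 => ->.
Qed.

Lemma metric_given_by_unique (g g' : 'M[R]_n -> 'M[R]_n -> 'M[R]_n -> R) :
  riemannian_metric g -> metric_given_by gamma alpha beta g ->
  riemannian_metric g' -> metric_given_by gamma alpha beta g' ->
  forall S X Y, spd S -> X \is symmetricmx -> Y \is symmetricmx -> g' S X Y = g S X Y.
Proof.
move=> gR gF g'R g'F S X Y Sspd XS YS.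
have diag Z : Z \is symmetricmx -> g' S Z Z = g S Z Z.
  move=> ZS; have [P [d [PP d_gt0 Sd]]] := spd_eigendecomposition Sspd.
  have ZE := esym (orthogonal_conjVK Z PP).
  have [-> ->] := g'F _ _ _ _ _ Sspd ZS PP d_gt0 Sd ZE.
  by have [-> ->] := gF _ _ _ _ _ Sspd ZS PP d_gt0 Sd ZE.
rewrite (inner_product_polarization (g'R S Sspd))//.
rewrite (inner_product_polarization (gR S Sspd))//.
by rewrite !diag//; exact: symmetricmx_add.
Qed.

End MetricOfFormula.

(** * Coefficients of an invariant metric *)

Lemma linear_form_delta (R : realType) n (b : 'M[R]_n -> R) (X : 'M[R]_n) :
  (forall a Y Z, b (a *: Y + Z) = a * b Y + b Z) ->
  b X = \sum_i \sum_j X i j * b (delta_mx i j).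
Proof.
move=> blin; have b0 : b 0 = 0.
  by have := blin (-1) 0 0; rewrite scaler0 addr0 mulN1r addNr.
have bD : {morph b : Y Z / Y + Z} by move=> Y Z; rewrite -[Y]scale1r blin mul1r scale1r.
rewrite {1}[X]matrix_sum_delta (big_morph b bD b0); apply: eq_bigr => i _.
rewrite (big_morph b bD b0); apply: eq_bigr => j _.
by rewrite -[X in b X]addr0 blin b0 addr0.
Qed.

Section Necessity.
Variables (R : realType) (n : nat) (i0 i1 : 'I_n).
Hypotheses (i0E : i0 = 0%N :> nat) (i1E : i1 = 1%N :> nat).
Variable g : 'M[R]_n -> 'M[R]_n -> 'M[R]_n -> R.
Hypotheses (gR : riemannian_metric g) (gO : orthogonal_invariant g).
Implicit Types (S P Q X Y Z : 'M[R]_n) (d : 'rV[R]_n) (s : 'S_n).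

Definition symmetric_part X : 'M[R]_n := 2^-1 *: (X + X^T).

(* Precomposing with the symmetric part makes g_S bilinear on all square matrices,
   so that it can be expanded in the basis of the delta_mx i j. *)
Definition extended_metric S X Y : R := g S (symmetric_part X) (symmetric_part Y).

Lemma symmetric_partP X : symmetric_part X \is symmetricmx.
Proof. by apply/symmetricmxP; rewrite linearZ linearD /= trmxK addrC. Qed.

Lemma symmetric_part_tr X : symmetric_part X^T = symmetric_part X.
Proof. by rewrite /symmetric_part trmxK addrC. Qed.

Lemma symmetric_part_id X : X \is symmetricmx -> symmetric_part X = X.
Proof.
move=> /symmetricmxP XT; rewrite /symmetric_part XT -{1 2}[X]scale1r -scalerDl scalerA.
by rewrite mulVf ?scale1r// pnatr_eq0.
Qed.

Lemma symmetric_part_conj Q X :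
  symmetric_part (Q *m X *m Q^T) = Q *m symmetric_part X *m Q^T.
Proof.
by rewrite /symmetric_part !trmx_mul trmxK -scalemxAr -scalemxAl mulmxDr mulmxDl !mulmxA.
Qed.

Lemma extended_metric_lin S (a : R) X Y Z : spd S ->
  extended_metric S (a *: X + Y) Z = a * extended_metric S X Z + extended_metric S Y Z.
Proof.
move=> Sspd; have [glin _ _] := gR Sspd; rewrite /extended_metric.
have -> : symmetric_part (a *: X + Y) = a *: symmetric_part X + symmetric_part Y.
  rewrite /symmetric_part [(_ + _)^T]linearD /= [(_ *: _)^T]linearZ /=.
  by rewrite addrACA -[a *: X + _]scalerDr [LHS]scalerDr !scalerA [a * _]mulrC.
by rewrite glin//; exact: symmetric_partP.
Qed.

Lemma extended_metricC S X Y : spd S -> extended_metric S X Y = extended_metric S Y X.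
Proof. by move=> /gR[_ gC _]; apply: gC; exact: symmetric_partP. Qed.

(** Invariance is assumed for g(X, X); polarising both sides extends it to pairs. *)
Lemma extended_metric_invariant Q S X Y : orthogonal_mx Q -> spd S ->
  extended_metric (Q *m S *m Q^T) (Q *m X *m Q^T) (Q *m Y *m Q^T) =
  extended_metric S X Y.
Proof.
move=> QQ Sspd; rewrite /extended_metric !symmetric_part_conj.
have [XS YS] := (symmetric_partP X, symmetric_partP Y).
rewrite (inner_product_polarization (gR (spd_conj QQ Sspd))); try exact: symmetricmx_conj.
rewrite (inner_product_polarization (gR Sspd))// -mulmxDl -mulmxDr.
by rewrite !gO//; exact: symmetricmx_add.
Qed.

Lemma extended_metricE S X Y : X \is symmetricmx -> Y \is symmetricmx ->
  extended_metric S X Y = g S X Y.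
Proof. by move=> XS YS; rewrite /extended_metric !symmetric_part_id. Qed.

Definition coef d i j k l := extended_metric (diag_mx d) (delta_mx i j) (delta_mx k l).

Lemma coefC d i j k l : positive_vec d -> coef d i j k l = coef d k l i j.
Proof. by move=> /spd_diag Dspd; apply: extended_metricC. Qed.

Lemma coef_trl d i j k l : coef d i j k l = coef d j i k l.
Proof. by rewrite /coef /extended_metric -(trmx_delta _ j i) symmetric_part_tr. Qed.

Lemma coef_trr d i j k l : coef d i j k l = coef d i j l k.
Proof. by rewrite /coef /extended_metric -(trmx_delta _ l k) symmetric_part_tr. Qed.

Lemma extended_metric_delta d X : positive_vec d ->
  extended_metric (diag_mx d) X X =
  \sum_i \sum_j X i j * \sum_k \sum_l X k l * coef d k l i j.
Proof.
move=> /spd_diag Dspd.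
rewrite (@linear_form_delta _ _ (extended_metric (diag_mx d) ^~ X)); last first.
  by move=> a Y Z; rewrite /= extended_metric_lin.
apply: eq_bigr => i _; apply: eq_bigr => j _; congr (_ * _).
rewrite /= extended_metricC//.
apply: (@linear_form_delta _ _ (extended_metric (diag_mx d) ^~ _)).
by move=> a Y Z; rewrite extended_metric_lin.
Qed.

Lemma orthogonal_perm_mx s : orthogonal_mx (perm_mx s : 'M[R]_n).
Proof. by rewrite /orthogonal_mx tr_perm_mx -perm_mxM mulgV perm_mx1. Qed.

Lemma perm_mx_conj s X : perm_mx s *m X *m (perm_mx s)^T = \matrix_(i, j) X (s i) (s j).
Proof.
rewrite tr_perm_mx -row_permE -[s in (s^-1)%g]invgK.
by rewrite -col_permE; apply/matrixP => i j; rewrite !mxE invgK.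
Qed.

(** Conjugation by the permutation matrix of s turns the elementary matrix at (s i, s j) into the
    one at (i, j), and permutes the entries of d. *)
Lemma coef_col_perm s d i j k l : positive_vec d ->
  coef (col_perm s d) i j k l = coef d (s i) (s j) (s k) (s l).
Proof.
move=> d_gt0; rewrite /coef.
rewrite -[RHS](extended_metric_invariant _ _ (orthogonal_perm_mx s) (spd_diag d_gt0)).
rewrite !perm_mx_conj; congr extended_metric; apply/matrixP => a b;
  by rewrite !mxE !(inj_eq perm_inj).
Qed.

(* Changing the sign of the m-th basis vector fixes diag_mx d. *)
Lemma coef_sign d m i j k l : positive_vec d ->
  coef d i j k l = (-1) ^+ ((i == m) + (j == m) + (k == m) + (l == m))%N * coef d i j k l.
Proof.
move=> d_gt0; have Dspd := spd_diag d_gt0.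
pose sg (i : 'I_n) : R := (-1) ^+ (i == m).
pose Q : 'M[R]_n := diag_mx (\row_i sg i).
have sg2 a : sg a * sg a = 1 by rewrite -expr2 sqrr_sign.
have QX X : Q *m X *m Q^T = \matrix_(a, b) (sg a * X a b * sg b).
  by apply/matrixP => a b; rewrite tr_diag_mx mul_mx_diag mul_diag_mx !mxE.
have QQ : orthogonal_mx Q.
  rewrite /orthogonal_mx -[Q in Q *m _]mulmx1 QX; apply/matrixP => a b; rewrite !mxE.
  by have [->|] := eqVneq a b; rewrite ?mulr1 ?sg2// mulr0 mul0r.
have Qdelta a b : Q *m delta_mx a b *m Q^T = (sg a * sg b) *: delta_mx a b.
  rewrite QX; apply/matrixP => a' b'; rewrite !mxE mulrAC.
  have [->|_] := eqVneq a' a; last by rewrite !mulr0.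
  by have [->|_] := eqVneq b' b; rewrite // !mulr0.
have lin a X Y : extended_metric (diag_mx d) (a *: X) Y =
    a * extended_metric (diag_mx d) X Y.
  rewrite -[a *: X]addr0 extended_metric_lin//.
  rewrite (@linear_form_delta _ _ (extended_metric (diag_mx d) ^~ Y) 0) ?big1 ?addr0//.
    by move=> ? _; apply: big1 => ? _; rewrite mxE mul0r.
  by move=> b Z W; rewrite extended_metric_lin.
rewrite {1}/coef -(extended_metric_invariant _ _ QQ Dspd) !Qdelta.
have -> : Q *m diag_mx d *m Q^T = diag_mx d.
  rewrite QX; apply/matrixP => a b; rewrite !mxE.
  by have [->|] := eqVneq a b; rewrite ?mulr0 ?mul0r// mulr1n mulrAC sg2 mul1r.
rewrite lin extended_metricC// lin extended_metricC// -/(coef d i j k l).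
by rewrite /sg !exprD !mulrA.
Qed.

Lemma coef_odd d m i j k l : positive_vec d ->
  odd ((i == m) + (j == m) + (k == m) + (l == m)) -> coef d i j k l = 0.
Proof.
move=> d_gt0 o; have := coef_sign m i j k l d_gt0.
by rewrite -signr_odd o expr1; lra.
Qed.

(** The index k occurs once in (k, l), and zero or two times in (i, i). *)
Lemma coef_diag_offdiag d k l i : positive_vec d -> k != l -> coef d k l i i = 0.
Proof.
move=> d_gt0 kl; apply: (@coef_odd _ k) => //.
by rewrite eqxx eq_sym (negPf kl); case: (i == k).
Qed.

(** For k and l distinct with {k, l} different from {i, j}, some index occurs an odd number of
    times: k if it is neither i nor j, and l otherwise. *)
Lemma coef_offdiag d i j k l : positive_vec d -> i != j ->
  (k, l) != (i, j) -> (k, l) != (j, i) -> coef d k l i j = 0.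
Proof.
move=> d_gt0 ij; have [<-{l} _ _|kl] := eqVneq k l.
  by rewrite coefC// coef_diag_offdiag.
rewrite !xpair_eqE; have lk : l == k = false by rewrite eq_sym (negPf kl).
have ji : j == i = false by rewrite eq_sym (negPf ij).
move=> n1 n2; have [ik|ik] := boolP ((i == k) || (j == k)); last first.
  apply: (@coef_odd _ k) => //; move: ik; rewrite negb_or => /andP[/negPf-> /negPf->].
  by rewrite eqxx lk.
apply: (@coef_odd _ l) => //; rewrite eqxx (negPf kl).
case/orP: ik => /eqP ?; subst k.
  by rewrite (negPf kl) eq_sym; move: n1; rewrite eqxx /= => /negPf->.
by rewrite (negPf kl) eq_sym; move: n2; rewrite eqxx /= => /negPf->.
Qed.

Definition gamma_of d := coef d i0 i0 i0 i0.
(** In the expansion of g_D(X, X), the basis elements at (i, j) and at (j, i) pair equally with the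
    one at (i, j); hence the factor 2. *)
Definition alpha_of d := 2 * coef d i0 i1 i0 i1.
Definition beta_of d := coef d i0 i0 i1 i1.

Lemma gamma_of_to_front d i : positive_vec d ->
  gamma_of (to_front [:: i] d) = coef d i i i i.
Proof.
move=> d_gt0; have [//|u [-> uk]] := @to_front_perm R _ [:: i].
by rewrite /gamma_of coef_col_perm// uk i0E.
Qed.

Lemma alpha_of_to_front d i j : positive_vec d -> i != j ->
  alpha_of (to_front [:: i; j] d) = 2 * coef d i j i j.
Proof.
move=> d_gt0 ij.
have [|u [-> uk]] := @to_front_perm R _ [:: i; j]; first by rewrite /= inE ij.
by rewrite /alpha_of coef_col_perm// !uk ?i0E ?i1E.
Qed.

Lemma beta_of_to_front d i j : positive_vec d -> i != j ->
  beta_of (to_front [:: i; j] d) = coef d i i j j.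
Proof.
move=> d_gt0 ij.
have [|u [-> uk]] := @to_front_perm R _ [:: i; j]; first by rewrite /= inE ij.
by rewrite /beta_of coef_col_perm// !uk ?i0E ?i1E.
Qed.

Lemma metric_formula_of d X : positive_vec d -> X \is symmetricmx ->
  g (diag_mx d) X X = metric_formula gamma_of alpha_of beta_of d X.
Proof.
move=> d_gt0 XS; rewrite -extended_metricE// extended_metric_delta//.
have XT i j : X j i = X i j by have /symmetricmxP/matrixP/(_ i j) := XS; rewrite mxE.
have inner_diag i : \sum_k \sum_l X k l * coef d k l i i = \sum_k X k k * coef d k k i i.
  apply: eq_bigr => k _; rewrite (bigD1 k)//= big1 ?addr0// => l lk.
  by rewrite coef_diag_offdiag ?mulr0// eq_sym.
have inner_offdiag i j : i != j ->
    \sum_k \sum_l X k l * coef d k l i j = 2 * coef d i j i j * X i j.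
  move=> ij; rewrite pair_big /= (bigD1 (i, j))//= (bigD1 (j, i))/=; last first.
    by rewrite xpair_eqE negb_and eq_sym ij.
  rewrite big1 => [|[k l] /andP[n1 n2]]; last by rewrite /= coef_offdiag ?mulr0.
  by rewrite (coef_trl d j i) XT; ring.
rewrite /metric_formula -!big_split; apply: eq_bigr => i _ /=.
rewrite (bigD1 i)//= inner_diag addrAC; congr (_ + _); last first.
  under [RHS]eq_bigl do rewrite eq_sym.
  apply: eq_bigr => j ji; have ij : i != j by rewrite eq_sym.
  by rewrite inner_offdiag// alpha_of_to_front//; ring.
rewrite (bigD1 i)//= mulrDr gamma_of_to_front//; congr (_ + _); first by ring.
under [RHS]eq_bigl do rewrite eq_sym.
rewrite mulr_sumr; apply: eq_bigr => j ji; have ij : i != j by rewrite eq_sym.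
by rewrite beta_of_to_front// coefC//; ring.
Qed.

Lemma metric_given_by_of : metric_given_by gamma_of alpha_of beta_of g.
Proof.
move=> S P X X' d Sspd XS PP d_gt0 Sd XX'.
have X'S : X' \is symmetricmx.
  by have := symmetricmx_conj P^T XS; rewrite trmxK XX' orthogonal_conjK.
by rewrite Sd XX' gO ?metric_formula_of//; exact: spd_diag.
Qed.

Lemma compatibility_of : compatibility gamma_of alpha_of beta_of.
Proof.
move=> d i j i0' i1' d_gt0.
have [-> ->] : i = i0 /\ j = i1 by split; apply: val_inj; rewrite /= ?i0' ?i1'.
move=> {i j i0' i1'} d01; have Dspd := spd_diag d_gt0.
have i01 : i0 != i1 by rewrite -val_eqE /= i0E i1E.
have i10 : i1 != i0 by rewrite eq_sym.
(* The vector (1, 2) makes the matrix of the reflection rational. *)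
pose e i : 'rV[R]_n := delta_mx 0 i; pose v := e i0 + 2 *: e i1.
have ee i j : e i *m (e j)^T = (i == j)%:R%:M.
  rewrite trmx_delta; apply/matrixP => a b; rewrite !ord1.
  by have [<-|ij] := eqVneq i j; rewrite ?mul_delta_mx ?mul_delta_mx_0// !mxE.
have ev : e i0 *m v^T = 1%:M.
  rewrite linearD linearZ /= mulmxDr -scalemxAr !ee eqxx (negPf i01).
  by rewrite scale_scalar_mx mulr0 -raddfD /= addr0.
have vv : v *m v^T = 5%:M.
  rewrite {1}/v mulmxDl ev linearD linearZ /= -scalemxAl mulmxDr -scalemxAr !ee.
  rewrite eqxx (negPf i10) !scale_scalar_mx.
  apply/matrixP => a b; rewrite !ord1 !mxE eqxx !mulr1n mulr0n; ring.
pose H := reflection v.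
have HT : H^T = H by exact: reflection_tr.
have HH : orthogonal_mx H by rewrite /orthogonal_mx HT reflectionK.
(* As |v|^2 = 5 and e_0.v = 1, this is e_0 - (2/5) v. *)
have eH : e i0 *m H = (3 / 5) *: e i0 + (- 4 / 5) *: e i1.
  rewrite mul_reflection vv ev mul1mx mxE eqxx mulr1n /v scalerDr scalerA opprD addrA.
  by rewrite -{1}[e i0]scale1r -scalerBl -[- (_ *: e i1)]scaleNr; congr (_ *: _ + _ *: _); field.
(* Since the first two entries of d agree, v is an eigenvector of D, so H commutes with D. *)
have HD : H *m diag_mx d *m H^T = diag_mx d.
  have vD : v *m diag_mx d = d 0 i0 *: v.
    rewrite /v scalerDr mulmxDl -scalemxAl scalerA mulrC -scalerA.
    congr (_ + _ *: _); apply/rowP => j; rewrite mul_mx_diag !mxE.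
      by have [->|] := eqVneq j i0; rewrite /= ?mul1r ?mulr1// mul0r mulr0.
    by have [->|] := eqVneq j i1; rewrite /= ?mul1r ?mulr1// mul0r mulr0.
  have Dv : diag_mx d *m v^T = d 0 i0 *: v^T.
    by rewrite -[diag_mx d]tr_diag_mx -trmx_mul vD linearZ.
  have DH : H *m diag_mx d = diag_mx d *m H.
    rewrite /H mul_reflection /reflection mulmxBl mul1mx -scalemxAl.
    rewrite -[_ *m v *m diag_mx d]mulmxA vD Dv.
    by rewrite -scalemxAr -scalemxAl.
  by rewrite DH -mulmxA HH mulmx1.
pose E i j : 'M[R]_n := delta_mx i j.
(* The products of the coefficients 3/5 and -4/5. The trailing 0 gives the last summand the shape
   expected by [extended_metric_lin]. *)
have HE : H *m E i0 i0 *m H^T = (9 / 25) *: E i0 i0 +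
   ((- 12 / 25) *: E i0 i1 + ((- 12 / 25) *: E i1 i0 + ((16 / 25) *: E i1 i1 + 0))).
  have -> : E i0 i0 = (e i0)^T *m e i0 by rewrite trmx_delta mul_delta_mx.
  rewrite HT !mulmxA -{1}HT -trmx_mul -mulmxA eH.
  rewrite [(_ + _)^T]linearD /= ![(_ *: _)^T]linearZ /= mulmxDl -!scalemxAl !mulmxDr -!scalemxAr.
  rewrite !trmx_delta !mul_delta_mx !scalerDr !scalerA addr0 -!addrA.
  by congr (_ *: _ + (_ *: _ + (_ *: _ + _ *: _))); field.
have c1 : coef d i1 i1 i1 i1 = coef d i0 i0 i0 i0.
  by rewrite -{1}(col_perm_tperm d01) coef_col_perm// tpermR.
have b0 Z : extended_metric (diag_mx d) 0 Z = 0.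
  rewrite (@linear_form_delta _ _ (extended_metric (diag_mx d) ^~ Z) 0) ?big1//.
    by move=> ? _; apply: big1 => ? _; rewrite mxE mul0r.
  by move=> a Y W; rewrite extended_metric_lin.
have WL Z : extended_metric (diag_mx d) (H *m E i0 i0 *m H^T) Z =
    9 / 25 * extended_metric (diag_mx d) (E i0 i0) Z
    - 12 / 25 * extended_metric (diag_mx d) (E i0 i1) Z
    - 12 / 25 * extended_metric (diag_mx d) (E i1 i0) Z
    + 16 / 25 * extended_metric (diag_mx d) (E i1 i1) Z.
  by rewrite HE !extended_metric_lin// b0; ring.
(* After the odd coefficients vanish, invariance reads 625 gamma = 337 gamma + 288 beta + 288 alpha,
   where 337 = 9^2 + 16^2 and 288 = 2 * 9 * 16. *)
have := extended_metric_invariant (E i0 i0) (E i0 i0) HH Dspd.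
rewrite HD WL ![extended_metric _ _ (H *m _ *m _)]extended_metricC// !WL -!/(coef _ _ _ _ _).
rewrite /gamma_of /alpha_of /beta_of !(coef_trl d i1 i0) !(coef_trr d _ _ i1 i0).
rewrite (coefC i0 i0 i0 i1)// (coefC i1 i1 i0 i1)// (coefC i1 i1 i0 i0)// c1.
by rewrite !(coef_diag_offdiag _ d_gt0 i01); lra.
Qed.

(** S(d) is the Gram matrix of g_D on the diagonal matrices, in the basis of the E_ii. *)
Lemma positivity_of : positivity gamma_of beta_of.
Proof.
move=> d d_gt0; have [_ _ gpos] := gR (spd_diag d_gt0).
have SE i j : positivity_mx gamma_of beta_of d i j = coef d i i j j.
  rewrite mxE; have [<-|ij] := eqVneq; first exact: gamma_of_to_front.
  exact: beta_of_to_front.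
split=> [|x x_neq0].
  by apply/symmetricmxP/matrixP => i j; rewrite mxE !SE coefC.
pose X : 'M[R]_n := diag_mx x^T.
have XS : X \is symmetricmx by apply/symmetricmxP; rewrite tr_diag_mx.
have : 0 < g (diag_mx d) X X.
  apply: gpos => //; apply: contra_neq x_neq0 => X0; apply/colP => i.
  by have /matrixP/(_ i i) := X0; rewrite !mxE eqxx mulr1n.
rewrite -extended_metricE// extended_metric_delta//.
rewrite [X in _ < X -> _](_ : _ = (x^T *m positivity_mx gamma_of beta_of d *m x) 0 0)//.
have Xsum (F : 'I_n -> 'I_n -> R) i : \sum_j X i j * F i j = x i 0 * F i i.
  rewrite (bigD1 i)//= !mxE eqxx mulr1n big1 ?addr0// => j ji.
  by rewrite !mxE eq_sym (negPf ji) mulr0n mul0r.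
rewrite mxE; apply: eq_bigr => i _.
rewrite (Xsum (fun i j => \sum_k \sum_l X k l * coef d k l i j)) mulrC mxE.
congr (_ * _); apply: eq_bigr => k _.
by rewrite (Xsum (fun k l => coef d k l i i)) SE mxE.
Qed.

(** By [coef_col_perm] only the images of the first one or two indices matter: they are fixed, or
    swapped, and [coef] is unchanged by the swap. *)
Lemma symmetry_of : symmetry gamma_of alpha_of beta_of.
Proof.
have fix_out k s (i : 'I_n) : (i < k)%N ->
    perm_on [set i : 'I_n | (k <= i)%N]%SET s -> s i = i.
  by move=> ik sk; apply: out_perm sk _; rewrite inE -ltnNge.
have in0 (i : 'I_n) : (i < 1)%N -> i = i0.
  by rewrite ltnS leqn0 -i0E => /eqP/val_inj.
have in01 (i : 'I_n) : (i < 2)%N -> i = i0 \/ i = i1.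
  case: i => [[|[|]]]// ? _; [left|right]; apply: val_inj; by rewrite /= ?i0E ?i1E.
have s01 s : perm_on [set i : 'I_n | (i < 2)%N]%SET s ->
    (s i0 = i0 /\ s i1 = i1) \/ (s i0 = i1 /\ s i1 = i0).
  move=> sS; have := perm_closed i0 sS; have := perm_closed i1 sS.
  rewrite !inE i0E i1E => /in01[] s1 /in01[] s0; [|by right|by left|].
    by have := perm_inj (etrans s1 (esym s0)) => /(congr1 val); rewrite /= i0E i1E.
  by have := perm_inj (etrans s1 (esym s0)) => /(congr1 val); rewrite /= i0E i1E.
split; split=> s d d_gt0 sS; rewrite /gamma_of /alpha_of /beta_of coef_col_perm//.
- have := perm_closed i0 sS; rewrite !inE i0E => /in0.
  by move=> ->.
- by rewrite (fix_out _ _ _ _ sS) ?i0E.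
- by case: (s01 _ sS) => -[-> ->]//; rewrite coef_trl coef_trr.
- by rewrite !(fix_out _ _ _ _ sS) ?i0E ?i1E.
- by case: (s01 _ sS) => -[-> ->]//; rewrite coefC.
- by rewrite !(fix_out _ _ _ _ sS) ?i0E ?i1E.
Qed.

Lemma admissible_of : admissible gamma_of alpha_of beta_of.
Proof.
have i01 : i0 != i1 by rewrite -val_eqE /= i0E i1E.
have coef_gt0 d i j : positive_vec d -> 0 < coef d i j i j.
  move=> /spd_diag/gR[_ _ gpos]; apply: gpos; first exact: symmetric_partP.
  (* Entry (i, j) of the symmetric part of E_ij is 1/2, or 1 if i = j. *)
  apply/eqP => /matrixP/(_ i j)/eqP; rewrite !mxE !eqxx mulf_eq0 invr_eq0 pnatr_eq0 /=.
  by rewrite gt_eqF// ltr_pwDl.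
split.
- by move=> d /coef_gt0; apply.
- by move=> d /coef_gt0 c_gt0; rewrite mulr_gt0 ?ltr0n.
- exact: compatibility_of.
- exact: positivity_of.
- exact: symmetry_of.
Qed.

End Necessity.

(** * Continuity *)

Section MatrixConvergence.
Variables (R : realType) (T : Type) (F : set_system T).
Context {FF : Filter F}.

Lemma cvg_mx m n (f : T -> 'M[R]_(m, n)) (M : 'M[R]_(m, n)) :
  (forall i j, f t i j @[t --> F] --> M i j) -> f t @[t --> F] --> M.
Proof.
move=> fM A [B MB BA]; have : \forall t \near F, forall i j, B i j (f t i j).
  by apply: filter_forall => i; apply: filter_forall => j; apply: fM.
by apply: filterS => t ft; exact: BA.
Qed.

Lemma cvg_mx_coord m n (f : T -> 'M[R]_(m, n)) (M : 'M[R]_(m, n)) i j :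
  f t @[t --> F] --> M -> f t i j @[t --> F] --> M i j.
Proof. by move=> fM; apply: (cvg_comp f (fun N => N i j) fM); exact: coord_continuous. Qed.

Lemma cvg_sumr (I : Type) (r : seq I) (P : pred I) (f : I -> T -> R) (l : I -> R) :
  (forall i, P i -> f i t @[t --> F] --> l i) ->
  \sum_(i <- r | P i) f i t @[t --> F] --> \sum_(i <- r | P i) l i.
Proof. by apply: cvg_big; exact: add_continuous. Qed.

Lemma cvg_mulmx m n p (f : T -> 'M[R]_(m, n)) (g : T -> 'M[R]_(n, p))
    (M : 'M[R]_(m, n)) (N : 'M[R]_(n, p)) :
  f t @[t --> F] --> M -> g t @[t --> F] --> N -> f t *m g t @[t --> F] --> M *m N.
Proof.
move=> fM gN; apply: cvg_mx => i j; rewrite mxE.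
under eq_fun do rewrite mxE.
by apply: cvg_sumr => k _; apply: cvgM; exact: cvg_mx_coord.
Qed.

Lemma cvg_trmx m n (f : T -> 'M[R]_(m, n)) (M : 'M[R]_(m, n)) :
  f t @[t --> F] --> M -> (f t)^T @[t --> F] --> M^T.
Proof.
move=> fM; apply: cvg_mx => i j; rewrite mxE.
by under eq_fun do rewrite mxE; exact: cvg_mx_coord.
Qed.

End MatrixConvergence.

(** * From continuous coefficients to a continuous quadratic form *)

Section Continuity.
Variables (R : realType) (n : nat).
Implicit Types (d : 'rV[R]_n) (S X Q : 'M[R]_n).

(** Transported from row vectors, where a box of segments is compact: the set is closed as a
    preimage of the identity, and lies in a box because the rows have norm 1. *)
Lemma orthogonal_compact : compact [set Q : 'M[R]_n | orthogonal_mx Q].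
Proof.
pose K := [set v : 'rV[R]_(n * n) | orthogonal_mx (vec_mx v)].
have vec_cont : continuous (vec_mx : 'rV[R]_(n * n) -> 'M[R]_n).
  move=> v; apply: (@cvg_mx R _ (nbhs v)) => i j; rewrite mxE.
  by under eq_fun do rewrite mxE; exact: coord_continuous.
have -> : [set Q : 'M[R]_n | orthogonal_mx Q] = vec_mx @` K.
  apply/seteqP; split=> [Q QQ|_ [v vK <-]//].
  by exists (mxvec Q); rewrite /K /= ?mxvecK.
apply: continuous_compact; first exact: continuous_subspaceT.
pose box := [set v : 'rV[R]_(n * n) | forall i, `[-1, 1]%classic (v ord0 i)].
apply: (@subclosed_compact _ _ box).
- have -> : K = (fun v => vec_mx v *m (vec_mx v)^T) @^-1` [set 1%:M] by [].
  apply: preimage_closed => [v _|].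
    apply: (@cvg_mulmx R _ (nbhs v)); first exact: vec_cont.
    by apply: (@cvg_trmx R _ (nbhs v)); exact: vec_cont.
  by apply: accessible_closed_set1; apply: hausdorff_accessible; exact: norm_hausdorff.
- have := @rV_compact R (n * n) (fun=> `[(-1 : R), 1]%classic).
  by apply=> _; exact: segment_compact.
move=> v vK k; case: (mxvec_indexP k) => i j; rewrite /= in_itv /= -ler_norml.
have := congr1 (fun M : 'M[R]_n => M i i) vK; rewrite !mxE eqxx mulr1n => vv.
rewrite -[1]sqrtr1 -sqrtr_sqr ler_wsqrtr// -vv (bigD1 j)//= !mxE -expr2 lerDl.
by apply: sumr_ge0 => l _; rewrite !mxE -expr2 sqr_ge0.
Qed.

Lemma positive_vec_open : open [set d : 'rV[R]_n | positive_vec d].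
Proof.
rewrite openE => d d_gt0.
suff : \forall e \near d, positive_vec (e : 'rV[R]_n) by [].
have := @filter_forall 'rV[R]_n _ (fun i (e : 'rV[R]_n) => 0 < e 0 i) (nbhs d) _.
apply => i.
have := @coord_continuous R 1 n 0 i d.
by move=> /(cvgr_gt (d 0 i)) /(_ _ (d_gt0 i)).
Qed.

(** On an open set, continuity within it is continuity at each of its points. *)
Lemma continuous_on_positiveP (f : 'rV[R]_n -> R) : continuous_on_positive f <->
  forall d, positive_vec d -> f d' @[d' --> d] --> f d.
Proof.
rewrite /continuous_on_positive continuous_open_subspace; last exact: positive_vec_open.
by split=> fc d d_gt0; apply: fc; move: d_gt0; rewrite inE.
Qed.

Lemma cvg_to_front (T : Type) (F : set_system T) (FF : Filter F) I (f : T -> 'rV[R]_n) d :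
  f t @[t --> F] --> d -> to_front I (f t) @[t --> F] --> to_front I d.
Proof.
move=> fd; apply: cvg_mx => i j; rewrite mxE.
by under eq_fun do rewrite mxE; exact: cvg_mx_coord.
Qed.

Section Formula.
Variables gamma alpha beta : 'rV[R]_n -> R.
Hypotheses (gC : continuous_on_positive gamma) (aC : continuous_on_positive alpha)
  (bC : continuous_on_positive beta).

Lemma cvg_metric_formula (T : Type) (F : set_system T) (FF : Filter F)
    (f : T -> 'rV[R]_n) (h : T -> 'M[R]_n) d X :
  positive_vec d -> f t @[t --> F] --> d -> h t @[t --> F] --> X ->
  metric_formula gamma alpha beta (f t) (h t) @[t --> F] -->
  metric_formula gamma alpha beta d X.
Proof.
move=> d_gt0 fd hX.
have front I (c : 'rV[R]_n -> R) : continuous_on_positive c ->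
    c (to_front I (f t)) @[t --> F] --> c (to_front I d).
  move=> /continuous_on_positiveP cC.
  have tf_gt0 : positive_vec (to_front I d) by move=> i; rewrite mxE.
  exact: (cvg_comp _ c (cvg_to_front FF fd) (cC _ tf_gt0)).
have hXij i j : h t i j @[t --> F] --> X i j by exact: cvg_mx_coord.
rewrite /metric_formula; apply: cvgD; first apply: cvgD.
- apply: cvg_sumr => i _; apply: cvgM; first exact: front.
  by rewrite expr2; under eq_fun do rewrite expr2; apply: cvgM.
- apply: cvg_sumr => i _; apply: cvg_sumr => j _; apply: cvgM; first exact: front.
  by rewrite expr2; under eq_fun do rewrite expr2; apply: cvgM.
apply: cvg_sumr => i _; apply: cvg_sumr => j _; apply: cvgM; first exact: front.
exact: cvgM.
Qed.

(** Eigenvectors need not vary continuously where eigenvalues meet, so the estimate is proved for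
    all Q in O(n) at once, vacuously for those that do not diagonalise S'. *)
Lemma continuous_metric_quadratic (g : 'M[R]_n -> 'M[R]_n -> 'M[R]_n -> R) X :
  metric_given_by gamma alpha beta g -> X \is symmetricmx ->
  {within [set S | spd S], continuous (fun S : 'M[R]_n => g S X X)}.
Proof.
move=> gF XS; apply/subspace_continuousP => S /= Sspd.
pose F := within [set S | spd S] (nbhs S).
have FF : Filter F by exact: within_filter.
pose M S' Q : 'M[R]_n := Q^T *m S' *m Q.
pose dg S' Q : 'rV[R]_n := \row_i M S' Q i i.
have formula S' Q : spd S' -> orthogonal_mx Q -> is_diag_mx (M S' Q) ->
    positive_vec (dg S' Q) /\
    g S' X X = metric_formula gamma alpha beta (dg S' Q) (Q^T *m X *m Q).
  move=> S'spd QQ /is_diag_mxP Mdiag.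
  have ME : M S' Q = diag_mx (dg S' Q).
    apply/matrixP => i j; rewrite [RHS]mxE; have [->|ij] := eqVneq i j.
      by rewrite [RHS]mxE.
    by rewrite mulr0n Mdiag.
  have d_gt0 : positive_vec (dg S' Q).
    apply: spd_diag_positive; rewrite -ME.
    by have := spd_conj (orthogonal_trmx QQ) S'spd; rewrite trmxK.
  have S'E : S' = Q *m diag_mx (dg S' Q) *m Q^T by rewrite -ME orthogonal_conjVK.
  split=> //; have XE := esym (orthogonal_conjVK X QQ).
  by have [-> ->] := gF S' Q X _ _ S'spd XS QQ d_gt0 S'E XE.
apply/cvgrPdist_lt => e e_gt0.
pose P S' Q := spd S' -> is_diag_mx (M S' Q) -> `|g S X X - g S' X X| < e.
have nearP : \forall S' \near F, [set Q | orthogonal_mx Q] `<=` P S'.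
  (* Compactness, in its near-covering form, reduces a neighbourhood of S valid for all Q to a
     neighbourhood of (Q, S) for each Q. *)
  move: orthogonal_compact => /compact_near_coveringP/near_covering_withinP; apply=> Q QQ.
  pose G := filter_prod (nbhs Q) F.
  have GF : Filter G by exact: filter_prod_filter.
  have Qcvg : QS.1 @[QS --> G] --> Q by exact: cvg_fst.
  have Scvg : QS.2 @[QS --> G] --> S.
    by apply: (cvg_trans cvg_snd); exact: cvg_within.
  have Mcvg : M QS.2 QS.1 @[QS --> G] --> M S Q.
    have := cvg_mulmx (cvg_mulmx (cvg_trmx Qcvg) Scvg) Qcvg.
    by apply.
  suff : G [set QS | orthogonal_mx QS.1 -> P QS.2 QS.1] by [].
  have [Mdiag|] := boolP (is_diag_mx (M S Q)); last first.
    move=> /is_diag_mxP Mndiag.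
    have [i [j [ij Mij]]] : exists i j : 'I_n, i != j /\ M S Q i j != 0.
      apply: contrapT => noij; apply: Mndiag => i j ij; apply/eqP/negPn/negP => Mij.
      by apply: noij; exists i, j.
    (* Q does not diagonalise S: an off-diagonal entry stays nonzero nearby, where the claim is thus
       vacuous. *)
    have nearQS := cvgr_neq0 _ (cvg_mx_coord (i := i) (j := j) Mcvg) Mij.
    apply: (@filterS _ G GF _ _ _ (nearQS GF)) => QS QSij _ _.
    by move=> /is_diag_mxP/(_ i j ij) QSij0; rewrite QSij0 eqxx in QSij.
  have [d_gt0 gSX] := formula S Q Sspd QQ Mdiag.
  have dgcvg : dg QS.2 QS.1 @[QS --> G] --> dg S Q.
    apply: (cvg_mx (F := G)) => i j; rewrite mxE.
    by under eq_fun do rewrite mxE; exact: (cvg_mx_coord (F := G)).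
  have Xcvg : QS.1^T *m X *m QS.1 @[QS --> G] --> Q^T *m X *m Q.
    have := cvg_mulmx (cvg_mulmx (cvg_trmx Qcvg) (cvg_cst X)) Qcvg.
    by apply.
  have /cvgrPdist_lt/(_ e e_gt0) nearQS := cvg_metric_formula GF d_gt0 dgcvg Xcvg.
  apply: (@filterS _ G GF _ _ _ nearQS) => QS close QSO QSspd QSdiag.
  by rewrite gSX (formula _ _ QSspd QSO QSdiag).2.
have Fspd : F [set S | spd S] by exact: withinT.
apply: (@filterS2 _ F FF _ _ _ _ Fspd nearP) => S' /= S'spd SP.
have [Q [d [QQ _ S'E]]] := spd_eigendecomposition S'spd; apply: (SP Q) => //.
by rewrite S'E /M orthogonal_conjK// diag_mx_is_diag.
Qed.

End Formula.
End Continuity.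

(** * Equivalence of the continuity of the metric and of its coefficients *)

Section ContinuityEquivalence.
Variables (R : realType) (n : nat) (i0 i1 : 'I_n).
Hypotheses (i0E : i0 = 0%N :> nat) (i1E : i1 = 1%N :> nat).
Variables (g : 'M[R]_n -> 'M[R]_n -> 'M[R]_n -> R) (gamma alpha beta : 'rV[R]_n -> R).
Hypotheses (gR : riemannian_metric g) (adm : admissible gamma alpha beta).
Hypothesis gF : metric_given_by gamma alpha beta g.
Implicit Types (S X Y : 'M[R]_n) (d : 'rV[R]_n).

Lemma continuous_metric_of_coefficients :
  continuous_on_positive gamma -> continuous_on_positive alpha ->
  continuous_on_positive beta -> continuous_metric g.
Proof.
move=> gC aC bC X Y XS YS; have XYS := symmetricmx_add XS YS.
have quad Z : Z \is symmetricmx -> forall S, spd S ->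
    g S' Z Z @[S' --> within [set S | spd S] (nbhs S)] --> g S Z Z.
  by move=> ZS; apply/subspace_continuousP; exact: (continuous_metric_quadratic gC aC bC).
apply/subspace_continuousP => S /= Sspd.
have lim : (g S' (X + Y) (X + Y) - g S' X X - g S' Y Y) / 2
    @[S' --> within [set S | spd S] (nbhs S)] --> g S X Y.
  rewrite (inner_product_polarization (gR Sspd) XS YS).
  apply: cvgM; last exact: cvg_cst.
  by apply: cvgB; [apply: cvgB|]; exact: quad.
apply: cvg_trans (near_eq_cvg _) lim; apply: filterS (withinT _ _) => S' S'spd.
by rewrite -inner_product_polarization//; exact: gR.
Qed.

(** Two inner products with the same quadratic form coincide, by polarisation. *)
Lemma metric_bilinear_formula d X Y : positive_vec d ->
  X \is symmetricmx -> Y \is symmetricmx ->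
  g (diag_mx d) X Y = bilinear_formula gamma alpha beta d X Y.
Proof.
move=> d_gt0 XS YS; have Dspd := spd_diag d_gt0.
have bF : inner_product_Sym (bilinear_formula gamma alpha beta d).
  split=> [a X' Y' Z' _ _ _|X' Y' _ _|X' /symmetricmxP X'S X'_neq0].
  - exact: bilinear_formulaP.
  - exact: (bilinear_formulaC adm).
  - by rewrite bilinear_formula_diag; exact: (metric_formula_gt0 adm).
have one : orthogonal_mx (1%:M : 'M[R]_n) by rewrite /orthogonal_mx trmx1 mulmx1.
have diag Z : Z \is symmetricmx -> g (diag_mx d) Z Z = bilinear_formula gamma alpha beta d Z Z.
  move=> ZS; have [|//|_ ->] := gF Dspd ZS one d_gt0 _ (X' := Z).
  - by rewrite trmx1 mul1mx mulmx1.
  - by rewrite trmx1 mul1mx mulmx1.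
  - by rewrite bilinear_formula_diag.
rewrite (inner_product_polarization (gR Dspd))// (inner_product_polarization bF)//.
by rewrite !diag//; exact: symmetricmx_add.
Qed.

Let i01 : i0 != i1. Proof. by rewrite -val_eqE /= i0E i1E. Qed.

Lemma to_front_first k f I d : symmetric_fun k f -> positive_vec d -> uniq I ->
  size I = k -> [set x in I]%SET = first_indices n k -> f (to_front I d) = f d.
Proof.
move=> fS d_gt0 uI sI IE; have [u [-> uk]] := @to_front_perm R _ _ uI.
rewrite -[in RHS](_ : col_perm 1%g d = d); last by apply/rowP => j; rewrite mxE perm1.
apply: (symmetric_fun_imset fS) => //.
have := imset_first_indices uI uk; rewrite sI IE => ->.
by apply/esym; rewrite -[RHS]imset_id; apply: eq_imset => j; rewrite perm1.
Qed.

(** Recovers the coefficients by evaluating g at fixed matrices, so that they inherit its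
    continuity. *)
Lemma coefficients_of_metric d : positive_vec d ->
  [/\ gamma d = g (diag_mx d) (delta_mx i0 i0) (delta_mx i0 i0),
      beta d = g (diag_mx d) (delta_mx i0 i0) (delta_mx i1 i1) &
      alpha d = g (diag_mx d) (delta_mx i0 i1 + delta_mx i1 i0)
                              (delta_mx i0 i1 + delta_mx i1 i0) / 2].
Proof.
move=> d_gt0; have [_ _ _ _ [gS aS bS]] := adm.
have i10 : i1 != i0 by rewrite eq_sym.
have deltaS i : (delta_mx i i : 'M[R]_n) \is symmetricmx.
  by apply/symmetricmxP; rewrite trmx_delta.
have FS : (delta_mx i0 i1 + delta_mx i1 i0 : 'M[R]_n) \is symmetricmx.
  by apply/symmetricmxP; rewrite linearD /= !trmx_delta addrC.
have first1 : [set x in [:: i0]]%SET = first_indices n 1.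
  by apply/setP => i; rewrite !inE ltnS leqn0 -i0E.
have first2 : [set x in [:: i0; i1]]%SET = first_indices n 2.
  by apply/setP => -[[|[|m]] ?]; rewrite !inE -!val_eqE /= i0E i1E.
have delta0 i a b : a != b -> (delta_mx a b : 'M[R]_n) i i = 0.
  by move=> ab; rewrite mxE; have [->|] := eqVneq i a; rewrite ?(negPf ab).
have delta_diag0 i j a : i != j -> (delta_mx a a : 'M[R]_n) i j = 0.
  by move=> ij; rewrite mxE; have [<-|] := eqVneq i a; rewrite // eq_sym (negPf ij).
rewrite !metric_bilinear_formula// /bilinear_formula; split.
- rewrite [X in _ + X + _]big1 => [|i _]; last first.
    by apply: big1 => j ij; rewrite delta_diag0// mul0r mulr0.
  rewrite [X in _ + _ + X]big1 => [|i _]; last first.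
    apply: big1 => j ij; rewrite !mxE; have [ii0|] := eqVneq i i0; last by rewrite mul0r mulr0.
    by rewrite -ii0 eq_sym (negPf ij) !mulr0.
  rewrite (bigD1 i0)//= big1 => [|i /negPf ii0]; last by rewrite !mxE ii0 mul0r mulr0.
  by rewrite !mxE eqxx !addr0 !mulr1 (to_front_first gS).
- rewrite [X in X + _ + _]big1 => [|i _]; last first.
    rewrite !mxE; have [->|] := eqVneq i i0; last by rewrite mul0r mulr0.
    by rewrite (negPf i01) !mulr0.
  rewrite [X in _ + X + _]big1 => [|i _]; last first.
    by apply: big1 => j ij; rewrite delta_diag0// mul0r mulr0.
  rewrite (bigD1 i0)//= [X in _ + (_ + X)]big1 => [|i /negPf ii0]; last first.
    by apply: big1 => j _; rewrite !mxE ii0 mul0r mulr0.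
  rewrite (bigD1 i1)//= [X in _ + (_ + X + _)]big1 => [|j /andP[_ /negPf ji1]]; last first.
    by rewrite [delta_mx i1 i1 j j]mxE ji1 !mulr0.
  by rewrite !mxE !eqxx !addr0 !add0r !mulr1 (to_front_first bS)//= inE i01.
rewrite [X in X + _ + _]big1 => [|i _]; last by rewrite [_ i i]mxE !delta0// addr0 mul0r mulr0.
rewrite [X in _ + X]big1 => [|i _]; last first.
  by apply: big1 => j _; rewrite [_ i i]mxE !delta0// addr0 mul0r mulr0.
rewrite (bigD1 i0)//= (bigD1 i1 i10)//=.
rewrite [X in _ + (_ + (_ + X))]big1 => [|i /andP[ii0 ii1]]; last first.
  by apply: big1 => j _; rewrite !mxE (negPf ii0) (negPf ii1) addr0 mul0r mulr0.
rewrite (bigD1 i1)//= big1 => [|j /andP[_ ji1]]; last first.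
  by rewrite !mxE (negPf ji1) (negPf i01) andbF addr0 mul0r mulr0.
rewrite (bigD1 i0)//= big1 => [|j /andP[_ ji0]]; last first.
  by rewrite !mxE (negPf ji0) (negPf i10) andbF addr0 mul0r mulr0.
(* The terms at (0, 1) and (1, 0) both contribute [alpha d], whence the division by 2. *)
rewrite !mxE !eqxx (negPf i10) (negPf i01) /= -(to_front2C aS d_gt0 i01).
by rewrite (to_front_first aS)//= ?inE ?i01//; field.
Qed.

Lemma continuous_coefficients_of_metric : continuous_metric g ->
  [/\ continuous_on_positive alpha, continuous_on_positive beta
    & continuous_on_positive gamma].
Proof.
move=> gC.
have evalC X Y d : X \is symmetricmx -> Y \is symmetricmx -> positive_vec d ->
    g (diag_mx e) X Y @[e --> within (@positive_vec R n) (nbhs d)] --> g (diag_mx d) X Y.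
  move=> XS YS d_gt0.
  have /subspace_continuousP/(_ _ (spd_diag d_gt0)) := gC X Y XS YS.
  apply: (cvg_comp (fun e => diag_mx e) (fun S => g S X Y)) => A SA.
  have diagC : diag_mx e @[e --> d] --> diag_mx d.
    apply: (@cvg_mx R _ (nbhs d)) => i j; rewrite mxE; under eq_fun do rewrite mxE.
    case: (i == j); last exact: cvg_cst.
    exact: coord_continuous.
  apply: (@filterS _ (nbhs d) _ _ _ _ (diagC _ SA)) => e spdA e_gt0.
  by apply: spdA; exact: spd_diag.
(* The coefficients agree with evaluations of g on positive vectors only, so limits are taken within
   that set. *)
have eqC (f h : 'rV[R]_n -> R) : (forall d, positive_vec d -> f d = h d) ->
    (forall d, positive_vec d -> h e @[e --> within (@positive_vec R n) (nbhs d)] --> h d) ->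
    continuous_on_positive f.
  move=> fh hC; apply/subspace_continuousP => d /= d_gt0.
  have := hC d d_gt0; rewrite -fh// => lim.
  apply: cvg_trans (near_eq_cvg _) lim; apply: filterS (withinT _ _) => e e_gt0.
  exact/esym/fh.
have deltaS i : (delta_mx i i : 'M[R]_n) \is symmetricmx.
  by apply/symmetricmxP; rewrite trmx_delta.
have FS : (delta_mx i0 i1 + delta_mx i1 i0 : 'M[R]_n) \is symmetricmx.
  by apply/symmetricmxP; rewrite linearD /= !trmx_delta addrC.
split.
- apply: eqC => [d d_gt0|d d_gt0]; first by have [_ _ ->] := coefficients_of_metric d_gt0.
  by apply: cvgM; [exact: evalC|exact: cvg_cst].
- apply: eqC => [d d_gt0|d d_gt0]; first by have [_ -> _] := coefficients_of_metric d_gt0.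
  exact: evalC.
- apply: eqC => [d d_gt0|d d_gt0]; first by have [-> _ _] := coefficients_of_metric d_gt0.
  exact: evalC.
Qed.

End ContinuityEquivalence.

Theorem theorem5p1 (R : realType) (n : nat) (hn : (2 <= n)%N) :
  (forall g : 'M[R]_n -> 'M[R]_n -> 'M[R]_n -> R,
     riemannian_metric g -> orthogonal_invariant g ->
     exists gamma alpha beta : 'rV[R]_n -> R,
       admissible gamma alpha beta /\ metric_given_by gamma alpha beta g)
  /\
  (forall gamma alpha beta : 'rV[R]_n -> R,
     admissible gamma alpha beta ->
     formula_well_defined gamma alpha beta /\
     exists g : 'M[R]_n -> 'M[R]_n -> 'M[R]_n -> R,
       [/\ riemannian_metric g, orthogonal_invariant g,
           metric_given_by gamma alpha beta g
         & forall g' : 'M[R]_n -> 'M[R]_n -> 'M[R]_n -> R,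
             riemannian_metric g' -> metric_given_by gamma alpha beta g' ->
             forall S X Y : 'M[R]_n,
               spd S -> X \is symmetricmx -> Y \is symmetricmx ->
               g' S X Y = g S X Y])
  /\
  (forall (g : 'M[R]_n -> 'M[R]_n -> 'M[R]_n -> R)
          (gamma alpha beta : 'rV[R]_n -> R),
     riemannian_metric g -> orthogonal_invariant g ->
     admissible gamma alpha beta -> metric_given_by gamma alpha beta g ->
     (continuous_metric g <->
      [/\ continuous_on_positive alpha, continuous_on_positive beta
        & continuous_on_positive gamma])).
Proof.
pose i0 : 'I_n := Ordinal (ltnW hn); pose i1 : 'I_n := Ordinal hn.
have i0E : i0 = 0%N :> nat by []; have i1E : i1 = 1%N :> nat by [].
split; last split.
- move=> g gR gO; exists (gamma_of i0 g), (alpha_of i0 i1 g), (beta_of i0 i1 g).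
  by split; [exact: admissible_of|exact: metric_given_by_of].
- move=> gamma alpha beta adm.
  split; first exact: (formula_well_definedP i0E i1E).
  exists (metric_of_formula gamma alpha beta); split.
  + exact: metric_of_formula_riemannian.
  + exact: (metric_of_formula_invariant i0E i1E).
  + exact: (metric_of_formula_given_by i0E i1E).
  move=> g' g'R g'F S X Y; apply: (metric_given_by_unique _ _ g'R g'F).
    exact: metric_of_formula_riemannian.
  exact: (metric_of_formula_given_by i0E i1E).
move=> g gamma alpha beta gR _ adm gF; split.
  exact: (continuous_coefficients_of_metric i0E i1E gR adm gF).
by move=> [aC bC gC]; exact: (continuous_metric_of_coefficients gR gF gC aC bC).
Qed.
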